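(* In the setting below, there exists a constant $A>0$ such that, as $t\nearrow T$, $$\frac{J_{\mathcal G}(t)}{(T-t)^{4/3}}\to A,\quad \frac{\dot J_{\mathcal G}(t)}{(T-t)^{1/3}}\to-\frac{4A}{3},\quad \frac{\ddot J_{\mathcal G}(t)}{(T-t)^{-2/3}}\to\frac{4A}{9},\quad \frac{U_{\mathcal G}(t)}{(T-t)^{-2/3}}\to\frac{2A}{9},\quad \frac{K_{\mathcal G}(t)}{(T-t)^{-2/3}}\to\frac{2A}{9}.$$ Moreover $H_{\mathcal G}(t)=K_{\mathcal G}(t)-U_{\mathcal G}(t)$ has a finite limit as $t\nearrow T$.
   Context: Setting: let $d\in\{2,3\}$, $n\ge2$, masses $m_1,\dots,m_n>0$, and let $q(t)=(q_1(t),\dots,q_n(t))$, $q_i(t)\in\mathbb{R}^d$, be a solution on $[t_0,T)$ of $m_i\ddot q_i=\partial U/\partial q_i$, $U(q)=\sum_{i<j}m_im_j/|q_i-q_j|$, with $q_i(t)\ne q_j(t)$ for $i\ne j$, $t<T$, such that every limit $L_i=\lim_{t\nearrow T}q_i(t)$ exists. Let $\mathcal G\subset\{1,\dots,n\}$ be a cluster with at least two elements: $L_i=L_j=:L_{\mathcal G}$ for $i,j\in\mathcal G$ and $L_j\neq L_{\mathcal G}$ for $j\notin\mathcal G$. Notation: $M_{\mathcal G}=\sum_{i\in\mathcal G}m_i$, $c_{\mathcal G}=M_{\mathcal G}^{-1}\sum_{i\in\mathcal G}m_iq_i$, $K_{\mathcal G}=\frac12\sum_{i\in\mathcal G}m_i|\dot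 q_i|^2$, $U_{\mathcal G}=\sum_{i<j,\,i,j\in\mathcal G}m_im_j/|q_i-q_j|$, $H_{\mathcal G}=K_{\mathcal G}-U_{\mathcal G}$, $J_{\mathcal G}=\sum_{i\in\mathcal G}m_i|q_i-L_i|^2$, $I^0_{\mathcal G}=\sum_{i\in\mathcal G}m_i|q_i-c_{\mathcal G}|^2$, $r_{\mathcal G}=\sqrt{I^0_{\mathcal G}}$ (all evaluated along $q(t)$). *)

(* Defs.v *)
From HB Require Import structures.
From mathcomp Require Import all_boot all_order all_algebra.
From mathcomp Require Import all_classical all_reals all_analysis.
Set Implicit Arguments. Unset Strict Implicit. Unset Printing Implicit Defensive.
Import Order.TTheory GRing.Theory Num.Theory.
Import numFieldNormedType.Exports.
Local Open Scope ring_scope.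

Section NBody.
Variables (R : realType) (n d : nat).

(* A configuration trajectory: q t i k = k-th coordinate of body i at time t. *)
Definition traj := R -> 'I_n -> 'I_d -> R.

Definition enorm (x : 'I_d -> R) : R := Num.sqrt (\sum_(k < d) x k ^+ 2).
Definition edist (x y : 'I_d -> R) : R := enorm (fun k => x k - y k).

Definition qcoord (q : traj) (i : 'I_n) (k : 'I_d) : R -> R := fun t => q t i k.

(* k-th component of dU/dq_i = sum_{j<>i} m_i m_j (q_j - q_i)/|q_j - q_i|^3 *)
Definition newton_force (m : 'I_n -> R) (q : traj) (t : R) (i : 'I_n) (k : 'I_d) : R :=
  \sum_(j < n | j != i) m i * m j * (q t j k - q t i k) / (edist (q t i) (q t j)) ^+ 3.

Definition J_G (m : 'I_n -> R) (L : 'I_n -> 'I_d -> R) (G : {set 'I_n}) (q : traj) (t : R) : R :=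
  \sum_(i in G) m i * \sum_(k < d) (q t i k - L i k) ^+ 2.

Definition K_G (m : 'I_n -> R) (G : {set 'I_n}) (q : traj) (t : R) : R :=
  2^-1 * \sum_(i in G) m i * \sum_(k < d) (derive1 (qcoord q i k) t) ^+ 2.

Definition U_G (m : 'I_n -> R) (G : {set 'I_n}) (q : traj) (t : R) : R :=
  \sum_(i in G) \sum_(j in G | (i < j)%N) m i * m j / edist (q t i) (q t j).

Definition H_G (m : 'I_n -> R) (G : {set 'I_n}) (q : traj) (t : R) : R :=
  K_G m G q t - U_G m G q t.

End NBody.

(* Main.v *)
Require Import Defs.
From HB Require Import structures.
From mathcomp Require Import all_boot all_order all_algebra.
From mathcomp Require Import all_classical all_reals all_analysis.
From mathcomp Require Import ring lra.
Import Order.TTheory GRing.Theory Num.Theory.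
Import numFieldNormedType.Exports.
Local Open Scope classical_set_scope.
Local Open Scope ring_scope.

(** Newton's law gives J'' = 2 K + 2 H + E with E bounded, and H' is the power of
    the forces exerted from outside the cluster, which are bounded, so that
    |H'| <= K + c.  Hence J' +- 2 H satisfy linear differential inequalities that
    bound H in terms of J'; as J' cannot stay nonnegative while J decreases to 0,
    J' is bounded above and H is bounded.  Then H + J'/2 + c t and
    - H + J'/2 + c t are nondecreasing and bounded above, so H converges.

    Since J'' = 2 U + 4 H + E and U >= kappa / sqrt J, J is eventually convex and
    decreasing.  By the Cauchy-Schwarz inequality J'^2 <= 8 J K, Sundman's
    function J'^2 / sqrt J + 4 C sqrt J is nonincreasing, and J'^2 >= 4 kappa sqrt J,
    so J'^2 / sqrt J has a positive limit l.  Therefore (J^(3/4))' tends to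
    - (3/4) sqrt l, which yields the asymptotics of J and J'.

    Finally |U'| <= c sqrt K U^2 is bounded by a multiple of U^(5/2), so U^(-3/2) is
    Lipschitz, and this is the Tauberian condition that allows the asymptotics of
    J' to be differentiated. *)

(** * One-variable calculus on a left neighbourhood *)

Section Calculus.
Context {R : realType}.
Implicit Types (f g : R -> R) (a b x T : R).

(** Trades the left-neighbourhood filter for an explicit interval [(b, T)], the form in which the
    later estimates are stated. *)
Lemma near_leftP (P : R -> Prop) T :
  (\forall t \near T^'-, P t) <-> exists2 b, b < T & forall t, b < t < T -> P t.
Proof.
split=> [|[b bT bP]]; last first.
  near=> t; apply: bP; apply/andP; split; last by near: t; exact: nbhs_left_lt.
  by near: t; exact: nbhs_left_gt.
rewrite /at_left /within /= => -[e /= e0 He].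
exists (T - e); first by rewrite ltrBlDr ltrDl.
move=> t /andP[t1 t2]; apply: He => //=.
by rewrite ger0_norm ?subr_ge0 1?ltW// ltrBlDr -ltrBlDl.
Unshelve. all: by end_near. Qed.

(** * Differentiation rules, the mean value theorem and monotonicity *)

Definition der f x (df : R) := is_derive x (1 : R) f df.

Lemma derM f g x (df dg : R) :
  der f x df -> der g x dg ->
  der (fun t => f t * g t) x (df * g x + f x * dg).
Proof.
move=> hf hg; apply: (@is_derive_eq _ _ _ _ _ _ _ _ (is_deriveM hf hg)).
by rewrite /= addrC [X in X + _]mulrC.
Qed.

Lemma derD f g x (df dg : R) :
  der f x df -> der g x dg -> der (fun t => f t + g t) x (df + dg).
Proof. exact: is_deriveD. Qed.

Lemma derN f x (df : R) : der f x df -> der (fun t => - f t) x (- df).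
Proof. exact: is_deriveN. Qed.

Lemma derC (c x : R) : der (fun=> c) x 0.
Proof. exact: is_derive_cst. Qed.

Lemma der_id (x : R) : der id x 1.
Proof. exact: is_derive_id. Qed.

Lemma der_comp f g x (df dg : R) :
  der g (f x) dg -> der f x df -> der (fun t => g (f t)) x (dg * df).
Proof. exact: is_derive1_comp. Qed.

Lemma derV f x (df : R) : f x != 0 -> der f x df ->
  der (fun t => (f t)^-1) x (- df / f x ^+ 2).
Proof.
move=> f0 hf; apply: (@is_derive_eq _ _ _ _ _ _ _ _ (is_deriveV f0 hf)).
by rewrite /= /GRing.scale/= mulrC mulrN mulNr.
Qed.

Lemma der_sqrt f x (df : R) : 0 < f x -> der f x df ->
  der (fun t => Num.sqrt (f t)) x (df / (2 * Num.sqrt (f x))).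
Proof.
move=> f0 hf; rewrite mulrC.
by apply: (@der_comp f (@Num.sqrt R)) => //; exact: is_derive1_sqrt.
Qed.

(** The rules above return unsimplified derivatives; this reduces the passage to the wanted form to
    an algebraic identity. *)
Lemma der_eq {f g x} {df dg : R} : der f x df -> f =1 g -> df = dg -> der g x dg.
Proof. by move=> hf /funext <- <-. Qed.

Lemma der_continuous f x (df : R) : der f x df -> {for x, continuous f}.
Proof. by move=> [df1 _]; apply/differentiable_continuous/derivable1_diffP. Qed.

Lemma mean_value f (df : R -> R) a b : a < b ->
  (forall x, a <= x <= b -> der f x (df x)) ->
  exists2 c, a < c < b & f b - f a = df c * (b - a).
Proof.
move=> ab h.
have [||c] := @MVT R f df a b ab.
- by move=> x /[!in_itv]/= /andP[ax xb]; apply: h; rewrite !ltW.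
- apply: derivable_within_continuous => x /[!in_itv]/= xab.
  by case: (h x xab).
- by rewrite in_itv/= => cab fab; exists c.
Qed.

Lemma der_ge0_le f (df : R -> R) a b :
  (forall x, a < x < b -> der f x (df x)) ->
  (forall x, a < x < b -> 0 <= df x) ->
  forall s t, a < s -> s <= t -> t < b -> f s <= f t.
Proof.
move=> h df0 s t as_; rewrite le_eqVlt => /predU1P[->//|st] tb.
have H x : s <= x <= t -> a < x < b.
  by move=> /andP[sx xt]; rewrite (lt_le_trans as_ sx) (le_lt_trans xt tb).
have [|c /andP[sc ct] fst] := mean_value f df s t st.
  by move=> x xst; exact/h/H.
rewrite -subr_ge0 fst; apply: mulr_ge0; last by rewrite subr_ge0 ltW.
by apply: df0; apply: H; rewrite !ltW.
Qed.

Lemma der_le0_ge f (df : R -> R) a b :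
  (forall x, a < x < b -> der f x (df x)) ->
  (forall x, a < x < b -> df x <= 0) ->
  forall s t, a < s -> s <= t -> t < b -> f t <= f s.
Proof.
move=> h df0 s t as_ st tb; rewrite -lerN2.
apply: (@der_ge0_le (fun x => - f x) (fun x => - df x) a b) => // x xab.
  exact/derN/h.
by rewrite oppr_ge0 df0.
Qed.

(** * One-sided limits and bounds at the right end of an interval *)

Lemma nondecreasing_left_cvg f a T (M : R) : a < T ->
  (forall s t, a < s -> s <= t -> t < T -> f s <= f t) ->
  (forall t, a < t < T -> f t <= M) -> exists l : R, f t @[t --> T^'-] --> l.
Proof.
move=> aT fmono fM.
have : cvg (f t @[t --> T^'-]).
  apply: nondecreasing_at_left_is_cvgr.
    apply/near_leftP; exists a => // t /andP[at_ tT] x y.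
    rewrite !in_itv/= => /andP[tx xT] /andP[ty yT] xy.
    by apply: fmono => //; exact: lt_trans at_ tx.
  apply/near_leftP; exists a => // t /andP[at_ tT]; exists M => z [y /=].
  rewrite in_itv/= => /andP[ty yT] <-; apply: fM.
  by rewrite yT (lt_trans at_ ty).
by move=> cf; exists (lim (f t @[t --> T^'-])).
Qed.

Lemma nonincreasing_left_cvg f a T (M : R) : a < T ->
  (forall s t, a < s -> s <= t -> t < T -> f t <= f s) ->
  (forall t, a < t < T -> M <= f t) -> exists l : R, f t @[t --> T^'-] --> l.
Proof.
move=> aT fmono fM.
have [| |l fl] := @nondecreasing_left_cvg (fun t => - f t) a T (- M) aT.
- by move=> s t as_ st tT; rewrite lerN2; exact: fmono.
- by move=> t taT; rewrite lerN2; exact: fM.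
- exists (- l); rewrite (_ : f = fun t => - - f t); first exact: cvgN.
  by apply/funext => t; rewrite opprK.
Qed.

Lemma nondecreasing_left_le f a T (l : R) :
  (forall s t, a < s -> s <= t -> t < T -> f s <= f t) ->
  f t @[t --> T^'-] --> l -> forall s, a < s < T -> f s <= l.
Proof.
move=> fmono fl s /andP[as_ sT].
apply: (ler_cvg_to (f := fun=> f s) _ fl); first exact: cvg_cst.
apply/near_leftP; exists s => // t /andP[st tT].
by apply: fmono => //; exact: ltW.
Qed.

Lemma left_lim_ge f a T (l M : R) : a < T -> f t @[t --> T^'-] --> l ->
  (forall t, a < t < T -> M <= f t) -> M <= l.
Proof.
move=> aT fl fM; apply: (ler_cvg_to (f := fun=> M) _ fl); first exact: cvg_cst.
by apply/near_leftP; exists a.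
Qed.

Lemma left_bounded f T (l : R) : f t @[t --> T^'-] --> l ->
  exists2 b, b < T & forall t, b < t < T -> `|f t| <= `|l| + 1.
Proof.
move=> fl; apply/near_leftP; near=> t.
have : `|l - f t| < 1 by near: t; exact: (@cvgr_dist_lt _ _ _ _ _ _ _ fl).
move=> h; rewrite -(subrK l (f t)) addrC (le_trans (ler_normD _ _))// lerD2l.
by rewrite distrC ltW.
Unshelve. all: by end_near. Qed.

Lemma left_lt f T (l M : R) : f t @[t --> T^'-] --> l -> l < M ->
  exists2 b, b < T & forall t, b < t < T -> f t < M.
Proof. by move=> fl lM; apply/near_leftP; exact: cvgr_lt fl _ lM. Qed.

End Calculus.

(** * Power asymptotics and a Tauberian lemma *)

Section PowerAsymptotics.
Context {R : realType}.
Implicit Types (f U e : R -> R) (x y p T A C D : R).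

Lemma powR_div x y p : 0 <= x -> 0 < y -> (x / y) `^ p = x `^ p / y `^ p.
Proof.
move=> x0 y0; have yp : y `^ p != 0 by rewrite gt_eqF// powR_gt0.
apply: (mulIf yp); rewrite divfK// -powRM ?divr_ge0 ?(ltW y0)// divfK//.
by rewrite gt_eqF.
Qed.

Lemma powR_continuous p x : 0 < x -> {for x, continuous (fun y => y `^ p)}.
Proof. by move=> x0; apply: der_continuous; exact: is_derive1_powR. Qed.

Lemma cvg_powR (X : Type) (F : set_system X) (FF : Filter F) (g : X -> R) (l p : R) :
  0 < l -> g t @[t --> F] --> l -> g t `^ p @[t --> F] --> l `^ p.
Proof.
by move=> l0 gl; apply: (cvg_comp g (fun y => y `^ p) gl); exact: powR_continuous.
Qed.

(** The gap approaches 0 from the right, which is the filter of [powR_cvg0]. *)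
Lemma left_gap_cvg T : T - t @[t --> T^'-] --> 0^'+.
Proof.
move=> P; rewrite /at_right /within/= => -[e /= e0 He]; apply/near_leftP.
exists (T - e); first by rewrite ltrBlDr ltrDl.
move=> t /andP[et tT]; apply: He; rewrite ?subr_gt0//= sub0r normrN ger0_norm.
  by rewrite ltrBlDr -ltrBlDl.
by rewrite subr_ge0 ltW.
Qed.

Lemma left_gap_powR_cvg0 T p : 0 < p -> (T - t) `^ p @[t --> T^'-] --> 0.
Proof. by move=> p0; apply: cvg_comp (left_gap_cvg T) (powR_cvg0 p0). Qed.

(** Dividing by the power [-2/3] of the gap is multiplying by its power [2/3], which tends to 0:
    bounded terms drop out of the asymptotics. *)
Lemma bounded_div_gap_cvg0 e a T C : a < T -> (forall t, a < t < T -> `|e t| <= C) ->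
  e t / (T - t) `^ (- (2 / 3)) @[t --> T^'-] --> 0.
Proof.
move=> aT eC.
have CT s : (s * C) * (T - t) `^ (2 / 3) @[t --> T^'-] --> 0.
  rewrite -[X in _ --> X](mulr0 (s * C)); apply: cvgM; first exact: cvg_cst.
  by apply: left_gap_powR_cvg0; lra.
apply: squeeze_cvgr (CT (-1)) (CT 1).
apply/near_leftP; exists a => // t /eC; rewrite powRN invrK ler_norml => /andP[h1 h2].
by rewrite !ler_wpM2r ?powR_ge0// ?mul1r// mulN1r.
Qed.

(** The homothety of ratio [k] centred at [T] preserves the approach to [T], so a limit may be
    evaluated at the rescaled instant. *)
Lemma left_rescale_cvg (k : R) T : 0 < k -> T - k * (T - t) @[t --> T^'-] --> T^'-.
Proof.
move=> k0 P /near_leftP[b bT bP]; apply/near_leftP.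
exists (T - (T - b) / k); first by rewrite ltrBlDr ltrDl divr_gt0// subr_gt0.
move=> t /andP[bt tT]; apply: bP; apply/andP; split; last first.
  by rewrite ltrBlDr ltrDl mulr_gt0// subr_gt0.
rewrite ltrBrDl -ltrBrDr mulrC -ltr_pdivlMr//.
by move: bt; lra.
Qed.

(* A limit for f / (T - t)^(1/3) does not by itself give one for f'.  Here it
   does because U^(-3/2) is Lipschitz: the mean value theorem between t and
   T - k^3 (T - t) gives the value of U at an intermediate point up to an error
   that vanishes as k tends to 1. *)
Lemma tauberian f U (U1 : R -> R) e a T A C D : a < T -> 0 < A ->
  (forall t, a < t < T -> der f t (2 * U t + e t)) ->
  (forall t, a < t < T -> `|e t| <= C) ->
  (forall t, a < t < T -> 0 < U t) ->
  (forall t, a < t < T -> der U t (U1 t)) ->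
  (forall t, a < t < T -> `|U1 t| <= D * U t `^ (5 / 2)) ->
  f t / (T - t) `^ (1 / 3) @[t --> T^'-] --> - (4 * A / 3) ->
  U t / (T - t) `^ (- (2 / 3)) @[t --> T^'-] --> 2 * A / 9.
Proof.
move=> aT A0 df eC U0 dU U1D flim.
(* [p] should be of the order of [T - t], and [U1D] bounds its derivative because
   [-(3/2) - 1 = -(5/2)]. *)
pose p t := U t `^ (- (3 / 2)).
(* [B k] equals [(4A/3)(1 - k) / (2(1 - k^3))], the limit of the normalised mean of [U] between [t]
   and [T - k^3 (T - t)]; cancelling [1 - k] gives a meaning to [B 1 = 2A/9]. *)
pose B (k : R) := 2 * A / 3 / (1 + k + k ^+ 2).
have B0 k : 0 < k -> 0 < B k.
  by move=> k0; rewrite divr_gt0 ?divr_gt0 ?mulr_gt0 ?addr_gt0 ?exprn_gt0.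
have p_lip s t : a < s -> s < t -> t < T -> `|p t - p s| <= 3 / 2 * D * (t - s).
  move=> as_ st tT.
  have [|c /andP[sc ct] ->] := mean_value p
      (fun t => - (3 / 2) * U t `^ (- (3 / 2) - 1) * U1 t) s t st.
    move=> x /andP[sx xt].
    have hx : a < x < T by rewrite (lt_le_trans as_ sx) (le_lt_trans xt tT).
    apply: (der_comp U (fun y => y `^ (- (3 / 2)))); last exact: dU.
    by apply: is_derive1_powR; exact: U0.
  have hc : a < c < T by rewrite (lt_trans as_ sc) (lt_trans ct tT).
  rewrite normrM [X in _ * X]gtr0_norm ?subr_gt0// ler_wpM2r ?subr_ge0 ?(ltW st)//.
  rewrite -mulrA mulNr normrN normrM ger0_norm// ler_wpM2l//.
  rewrite normrM [X in X * _]gtr0_norm ?powR_gt0 ?U0//.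
  rewrite -ler_pdivlMl ?powR_gt0 ?U0// -powRN mulrC (le_trans (U1D c hc))//.
  by rewrite (_ : - (- (3 / 2) - 1) = 5 / 2); last lra.
have xi_cvg k : 0 < k < 1 -> exists xi : R -> R,
    (forall t, a < t < T -> t < xi t /\ xi t < T - k ^+ 3 * (T - t)) /\
    p (xi t) / (T - t) @[t --> T^'-] --> B k `^ (- (3 / 2)).
  move=> /andP[k0 k1].
  have k3 : 0 < k ^+ 3 < 1 by rewrite exprn_gt0//= exprn_ilt1// ltW.
  (* The ratio is a cube, so that the cube root of the gap is multiplied by exactly [k]. *)
  pose s t := T - k ^+ 3 * (T - t).
  have sT t : t < T -> t < s t /\ s t < T.
    move=> tT; rewrite /s; have : k ^+ 3 * (T - t) < T - t.
      by rewrite gtr_pMl ?subr_gt0//; case/andP: k3.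
    have : 0 < k ^+ 3 * (T - t) by rewrite mulr_gt0 ?subr_gt0//; case/andP: k3.
    by lra.
  (* The mean value points are chosen as a function of [t]; outside [(a, T)] the value 0 is a
     dummy. *)
  have /choice[xi Hxi] : forall t, exists x, a < t < T -> t < x < s t /\
      f (s t) - f t = (2 * U x + e x) * (s t - t).
    move=> t; have [ht|] := pselect (a < t < T); last by exists 0.
    have [tlts sltT] : t < s t /\ s t < T by apply: sT; case/andP: ht.
    have [|x xts fx] := mean_value f (fun x => 2 * U x + e x) t (s t) tlts.
      move=> x /andP[tx xs]; apply: df; case/andP: ht => at_ _.
      by rewrite (lt_le_trans at_ tx) (le_lt_trans xs sltT).
    by exists x.
  have xi_in t : a < t < T -> a < xi t < T.
    move=> ht; have [/andP[h1 h2] _] := Hxi t ht; case/andP: ht => at_ tT.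
    by have [_ h3] := sT t tT; rewrite (lt_trans at_ h1) (lt_trans h2 h3).
  exists xi; split=> [t ht|].
    by have [/andP[]] := Hxi t ht.
  have fs_lim : k * (f (s t) / (T - s t) `^ (1 / 3)) - f t / (T - t) `^ (1 / 3)
      @[t --> T^'-] --> k * - (4 * A / 3) - - (4 * A / 3).
    apply: cvgB => //; apply: cvgM; first exact: cvg_cst.
    apply: cvg_comp (left_rescale_cvg (k ^+ 3) T _) flim.
    by case/andP: k3.
  have Uxi : U (xi t) / (T - t) `^ (- (2 / 3)) @[t --> T^'-] --> B k.
    (* The mean value identity solved for the normalised [U (xi t)]; its [e] term tends to 0. *)
    pose g t := (k * (f (s t) / (T - s t) `^ (1 / 3)) - f t / (T - t) `^ (1 / 3))
      / (2 * (1 - k ^+ 3)) - 2^-1 * (e (xi t) / (T - t) `^ (- (2 / 3))).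
    have gB : g t @[t --> T^'-] --> B k.
      have -> : B k = (k * - (4 * A / 3) - - (4 * A / 3)) / (2 * (1 - k ^+ 3)) - 2^-1 * 0.
        rewrite /B; field; apply/andP; split.
          by rewrite subr_eq0 gt_eqF//; case/andP: k3.
        by rewrite gt_eqF// !addr_gt0 ?exprn_gt0.
      apply: cvgB; first by apply: cvgM => //; exact: cvg_cst.
      apply: cvgM; first exact: cvg_cst.
      by apply: (bounded_div_gap_cvg0 _ a T C) => // t ht; exact/eC/xi_in.
    apply: cvg_trans gB; apply: near_eq_cvg; apply/near_leftP; exists a => // t ht.
    have [_ fxi] := Hxi t ht; case/andP: ht => at_ tT.
    have tau0 : 0 < T - t by rewrite subr_gt0.
    have r0 : 0 < (T - t) `^ (1 / 3) by rewrite powR_gt0.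
    have r3 : T - t = (T - t) `^ (1 / 3) ^+ 3.
      by rewrite -powR_mulrn ?powR_ge0// -powRrM divfK// powRr1// ltW.
    have r23 : (T - t) `^ (- (2 / 3)) = ((T - t) `^ (1 / 3) ^+ 2)^-1.
      by rewrite powRN -powR_mulrn ?powR_ge0// -powRrM; congr (_ `^ _)^-1; lra.
    have ts : (T - s t) `^ (1 / 3) = k * (T - t) `^ (1 / 3).
      rewrite /s opprB addrC subrK powRM ?(ltW tau0) ?exprn_ge0 ?(ltW k0)//.
      by rewrite -powR_mulrn ?(ltW k0)// -powRrM (_ : 3%:R * (1 / 3) = 1) ?powRr1 ?(ltW k0)//; lra.
    have st : s t - t = (1 - k ^+ 3) * (T - t) by rewrite /s; ring.
    rewrite /g ts r23; set r := (T - t) `^ (1 / 3) in r0 r3 *.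
    have -> : k * (f (s t) / (k * r)) - f t / r = (f (s t) - f t) / r.
      by field; rewrite !gt_eqF.
    rewrite fxi st r3; field; rewrite gt_eqF//= subr_eq0 gt_eqF//.
    by case/andP: k3.
  apply: cvg_trans (cvg_powR _ _ _ _ _ (- (3 / 2)) (B0 k k0) Uxi).
  apply: near_eq_cvg; apply/near_leftP; exists a => // t ht.
  have := U0 _ (xi_in t ht); case/andP: ht => at_ tT U0t.
  rewrite powR_div ?ltW ?powR_gt0 ?subr_gt0// -powRrM.
  rewrite (_ : - (2 / 3) * - (3 / 2) = 1); last lra.
  by rewrite powRr1 ?subr_ge0 ?ltW.
have p_lim : p t / (T - t) @[t --> T^'-] --> B 1 `^ (- (3 / 2)).
  apply/cvgrPdist_lt => eps eps0.
  (* First [k] is taken close to 1, to control the Lipschitz error and the variation of [B]; only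
     then is [t] taken close to [T]. *)
  have [k /andP[k0 k1] [Dk Bk]] : exists2 k : R, 0 < k < 1 &
      3 / 2 * D * (1 - k ^+ 3) < eps / 3 /\
      `|B 1 `^ (- (3 / 2)) - B k `^ (- (3 / 2))| < eps / 3.
    have cX n : k ^+ n @[k --> 1^'-] --> (1 : R) ^+ n.
      by apply: cvg_at_left_filter; exact: exprn_continuous.
    have c1 : 3 / 2 * D * (1 - k ^+ 3) @[k --> 1^'-] --> 3 / 2 * D * (1 - 1 ^+ 3).
      by apply: cvgM; [exact: cvg_cst|apply: cvgB; [exact: cvg_cst|exact: cX]].
    have c2 : B k `^ (- (3 / 2)) @[k --> 1^'-] --> B 1 `^ (- (3 / 2)).
      apply: cvg_powR; first exact: B0.
      apply: cvgM; first exact: cvg_cst.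
      apply: cvgV; first by rewrite gt_eqF// !addr_gt0 ?exprn_gt0.
      apply: cvgD; last exact: cX.
      by apply: cvgD; [exact: cvg_cst|exact: (cX 1)].
    have e3 : 0 < eps / 3 by rewrite divr_gt0.
    rewrite expr1n subrr mulr0 in c1.
    have : \forall k \near (1 : R)^'-, [/\ 0 < k, k < 1,
        3 / 2 * D * (1 - k ^+ 3) < eps / 3 &
        `|B 1 `^ (- (3 / 2)) - B k `^ (- (3 / 2))| < eps / 3].
      near=> k; split.
      - by near: k; exact: nbhs_left_gt.
      - by near: k; exact: nbhs_left_lt.
      - by near: k; exact: cvgr_lt c1 _ e3.
      - by near: k; exact: (@cvgr_dist_lt _ _ _ _ _ _ _ c2).
    move=> /filter_ex[k [? ? ? ?]]; exists k => //; exact/andP.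
  have [|xi [xi_in xi_lim]] := xi_cvg k; first by rewrite k0.
  have near_xi : \forall t \near T^'-,
      `|B k `^ (- (3 / 2)) - p (xi t) / (T - t)| < eps / 3.
    by apply: (@cvgr_dist_lt _ _ _ _ _ _ _ xi_lim); rewrite divr_gt0.
  have near_a : \forall t \near T^'-, a < t < T by apply/near_leftP; exists a.
  apply: filterS2 near_xi near_a => t pxi ht.
  have [txi xis] := xi_in t ht; case/andP: ht => at_ tT.
  have tau0 : 0 < T - t by rewrite subr_gt0.
  have k3 : 0 < k ^+ 3 * (T - t) by rewrite mulr_gt0// exprn_gt0.
  have xiT : xi t < T by lra.
  have D0 : 0 <= D.
    have ha : a < t < T by rewrite at_.
    by rewrite -(pmulr_lge0 _ (powR_gt0 (5 / 2) (U0 t ha))) (le_trans _ (U1D t ha)).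
  (* [xi t - t] is below [(1 - k^3) (T - t)], so the error relative to [T - t] is bounded uniformly
     in [t]. *)
  have pp : `|p (xi t) / (T - t) - p t / (T - t)| <= 3 / 2 * D * (1 - k ^+ 3).
    rewrite -mulrBl normrM normfV (gtr0_norm tau0) ler_pdivrMr//.
    rewrite (le_trans (p_lip t (xi t) at_ txi xiT))// -[leRHS]mulrA.
    rewrite ler_wpM2l ?mulr_ge0//; lra.
  have -> : B 1 `^ (- (3 / 2)) - p t / (T - t) =
     (B 1 `^ (- (3 / 2)) - B k `^ (- (3 / 2))) +
     (B k `^ (- (3 / 2)) - p (xi t) / (T - t)) +
     (p (xi t) / (T - t) - p t / (T - t)) by ring.
  rewrite (le_lt_trans (ler_normD _ _))//.
  have := ler_normD (B 1 `^ (- (3 / 2)) - B k `^ (- (3 / 2)))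
    (B k `^ (- (3 / 2)) - p (xi t) / (T - t)).
  by lra.
(* The exponent [-(2/3)] inverts [-(3/2)] and leads back from [p] to [U]. *)
have -> : 2 * A / 9 = (B 1 `^ (- (3 / 2))) `^ (- (2 / 3)).
  rewrite -powRrM (_ : - (3 / 2) * - (2 / 3) = 1); last lra.
  by rewrite powRr1 ?ltW ?B0// /B expr1n; field.
apply: cvg_trans (cvg_powR _ _ _ _ _ (- (2 / 3)) _ p_lim); last first.
  by rewrite powR_gt0// B0.
apply: near_eq_cvg; apply/near_leftP; exists a => // t ht.
have := U0 t ht; case/andP: ht => at_ tT U0t.
rewrite powR_div ?powR_ge0 ?subr_gt0// /p -powRrM.
rewrite (_ : - (3 / 2) * - (2 / 3) = 1); last lra.
by rewrite powRr1 // ltW.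
Unshelve. all: by end_near. Qed.

End PowerAsymptotics.

(** * Sundman's argument *)

(** With the integrating factor [expR (- k * t)], the inequality says that [z] below is
    nondecreasing, hence stays above [z b]. *)
Lemma gronwall_lower {R : realType} (y dy : R -> R) (k C a b T : R) : k != 0 ->
  a < b < T -> (forall t, a < t < T -> der y t (dy t)) ->
  (forall t, a < t < T -> k * y t - C <= dy t) ->
  exists M, forall t, b <= t < T -> M <= y t.
Proof.
move=> k0 /andP[ab bT] hy hdy.
pose z t := expR (- k * t) * (y t - C / k).
have dz t : a < t < T -> der z t (expR (- k * t) * (dy t - (k * y t - C))).
  move=> ht; apply: der_eq (derM _ _ _ _ _ (der_comp (fun t => - k * t) expR t _ _
    (is_derive_expR _) (derM _ _ _ _ _ (derC (- k) t) (der_id t)))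
    (derD _ _ _ _ _ (hy t ht) (derC (- (C / k)) t))) _ _ => //.
  by rewrite /=; field.
have zb t : b <= t < T -> z b <= z t.
  move=> /andP[bt tT]; apply: (der_ge0_le _ _ _ _ dz) => // x xaT.
  by rewrite mulr_ge0 ?expR_ge0 ?subr_ge0 ?hdy.
(* On [[b, T)] one has [|t| <= |b| + |T|], which bounds [expR (k * t)] whatever the sign of [k]. *)
exists (C / k - `|z b| * expR (`|k| * (`|b| + `|T|))) => t btT.
have -> : y t = C / k + expR (k * t) * z t.
  rewrite /z mulrA -expRD (_ : k * t + - k * t = 0) ?expR0; last by ring.
  by rewrite mul1r addrC subrK.
rewrite lerD2l; apply: (@le_trans _ _ (expR (k * t) * z b)); last first.
  by rewrite ler_wpM2l ?expR_ge0 ?zb.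
rewrite -mulNr mulrC; apply: (@le_trans _ _ (expR (k * t) * - `|z b|)); last first.
  by rewrite ler_wpM2l ?expR_ge0// lerNl -normrN ler_norm.
rewrite !mulrN lerN2 ler_wpM2r// ler_expR (le_trans (ler_norm _))// normrM.
rewrite ler_wpM2l//; case/andP: btT => bt tT.
have [|] := ger0P t => t0.
  by have := ler_norm T; have := normr_ge0 b; lra.
by have := ler_norm (- b); have := normr_ge0 T; rewrite normrN; lra.
Qed.

(** * Collapse of abstract scalar functions obeying the cluster inequalities *)

Section Collapse.
Context {R : realType} (a T : R) (J J1 U K H E H1 U1 : R -> R) (c kappa : R).
Hypothesis aT : a < T.
Hypothesis HE : forall t, H t = K t - U t.
Hypothesis J_gt0 : forall t, a < t < T -> 0 < J t.
Hypothesis J_le1 : forall t, a < t < T -> J t <= 1.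
Hypothesis J_lim : J t @[t --> T^'-] --> 0.
Hypothesis dJ : forall t, a < t < T -> der J t (J1 t).
Hypothesis dJ1 : forall t, a < t < T -> der J1 t (2 * K t + 2 * H t + E t).
Hypothesis E_le : forall t, a < t < T -> `|E t| <= c.
Hypothesis dH : forall t, a < t < T -> der H t (H1 t).
Hypothesis H1_le : forall t, a < t < T -> `|H1 t| <= K t + c.
Hypothesis J1_sq : forall t, a < t < T -> J1 t ^+ 2 <= 8 * J t * K t.
Hypothesis kappa_gt0 : 0 < kappa.
Hypothesis U_ge : forall t, a < t < T -> kappa / Num.sqrt (J t) <= U t.
Hypothesis dU : forall t, a < t < T -> der U t (U1 t).
Hypothesis U1_le : forall t, a < t < T -> `|U1 t| <= c * Num.sqrt (K t) * U t ^+ 2.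

Let K_ge0 t : a < t < T -> 0 <= K t.
Proof.
move=> ht; have J8 : 0 < 8 * J t by rewrite mulr_gt0 ?J_gt0.
by rewrite -(pmulr_rge0 _ J8) (le_trans _ (J1_sq t ht))// sqr_ge0.
Qed.

Let mid_in : a < (a + T) / 2 < T. Proof. by have := aT => ?; apply/andP; split; lra. Qed.

(** Otherwise [J] would be nondecreasing up to its limit 0, against its positivity. *)
Lemma J1_not_ge0 s : a < s < T -> (forall t, s <= t < T -> 0 <= J1 t) -> False.
Proof.
move=> /andP[as_ sT] J1_ge0.
have mono x y : s < x -> x <= y -> y < T -> J x <= J y.
  apply: (der_ge0_le _ J1) => t /andP[st tT]; first by apply: dJ; rewrite tT (lt_trans as_ st).
  by apply: J1_ge0; rewrite tT ltW.
have mT : s < (s + T) / 2 < T by apply/andP; split; lra.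
have := nondecreasing_left_le _ _ _ _ mono J_lim _ mT.
by apply/negP; rewrite -ltNge J_gt0//; apply/andP; split; lra.
Qed.

Lemma J1_H_bounded : exists b B, [/\ a < b, b < T &
  forall t, b < t < T -> J1 t <= B /\ `|H t| <= B].
Proof.
set b := (a + T) / 2; have /andP[ab bT] : a < b < T := mid_in.
(* The [2 * K] in the derivative of [J1] absorbs the [2 * K] from the bound on [2 * H1]. Subtracting
   [J] contributes [- J1], which makes the remaining [2 * H - J1] linear in the unknown
   [J1 - 2 * H - J], up to a bounded term. *)
have [M1 hM1] : exists M, forall t, b <= t < T -> M <= J1 t - 2 * H t - J t.
  apply: (gronwall_lower _ (fun t => 2 * K t + 2 * H t + E t - 2 * H1 t - J1 t)
     (-1) (3 * c + 1) a b T) => //.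
    move=> t ht; apply: der_eq (derD _ _ _ _ _ (derD _ _ _ _ _ (dJ1 t ht)
      (derN _ _ _ (derM _ _ _ _ _ (derC 2 t) (dH t ht)))) (derN _ _ _ (dJ t ht))) _ _ => //=.
    by ring.
  move=> t ht; have := E_le t ht; have := H1_le t ht; rewrite !ler_norml.
  by have := J_gt0 t ht; have := J_le1 t ht; move=> ? ? /andP[? ?] /andP[? ?]; lra.
have [M2 hM2] : exists M, forall t, b <= t < T -> M <= J1 t + 2 * H t + J t.
  apply: (gronwall_lower _ (fun t => 2 * K t + 2 * H t + E t + 2 * H1 t + J1 t)
     1 (3 * c + 1) a b T) => //.
    move=> t ht; apply: der_eq (derD _ _ _ _ _ (derD _ _ _ _ _ (dJ1 t ht)
      (derM _ _ _ _ _ (derC 2 t) (dH t ht))) (dJ t ht)) _ _ => //=.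
    by ring.
  move=> t ht; have := E_le t ht; have := H1_le t ht; rewrite !ler_norml.
  by have := J_gt0 t ht; have := J_le1 t ht; move=> ? ? /andP[? ?] /andP[? ?]; lra.
have inI t : b <= t < T -> a < t < T.
  by move=> /andP[bt ->]; rewrite (lt_le_trans ab bt).
pose D := `|M1| + `|M2| + 1.
(* The two lower bounds together control both signs of [H]; the summand 1 in [D] accounts for
   [J <= 1]. *)
have HJ1 t : b <= t < T -> 2 * `|H t| <= J1 t + D.
  move=> ht; have := hM1 t ht; have := hM2 t ht; have := J_le1 t (inI t ht); have := J_gt0 t (inI t ht).
  have := ler_norm (- M1); have := ler_norm (- M2); rewrite !normrN /D.
  have := normr_ge0 M1; have := normr_ge0 M2.
  by case: (ger0P (H t)) => ? *; lra.
pose C := D + 3 * `|c|.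
(* By [HJ1], [2 * H + J1] is at least [- D], and [C] outweighs [D] together with the bound on
   [E]. *)
have Jmono x y : b < x -> x <= y -> y < T ->
    J1 x + J x + C * x <= J1 y + J y + C * y.
  apply: (der_ge0_le (fun t => J1 t + J t + C * t)
    (fun t => 2 * K t + 2 * H t + E t + J1 t + C)).
    move=> t /andP[bt tT]; have ht : a < t < T by apply: inI; rewrite tT ltW.
    apply: der_eq (derD _ _ _ _ _ (derD _ _ _ _ _ (dJ1 t ht) (dJ t ht))
      (derM _ _ _ _ _ (derC C t) (der_id t))) _ _ => //=.
    by ring.
  move=> t /andP[bt tT]; have ht' : b <= t < T by rewrite tT ltW.
  have ht := inI t ht'.
  have := E_le t ht; have := HJ1 t ht'; have := K_ge0 t ht.
  rewrite ler_norml => ? ? /andP[? ?]; have := ler_norm (- H t); rewrite normrN.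
  by have := ler_norm c; rewrite /C; have := normr_ge0 c; lra.
have C_ge0 : 0 <= C.
  by rewrite /C /D; do !rewrite addr_ge0//; rewrite mulr_ge0.
(* By [Jmono], a value of [J1] above this bound would keep [J1] nonnegative up to [T], which
   [J1_not_ge0] excludes. *)
have J1_le s : b < s < T -> J1 s <= 1 + C * (T - b).
  move=> hs; case/andP: (hs) => bs sT; rewrite leNgt; apply/negP => J1s.
  apply: (J1_not_ge0 s); first by apply: inI; rewrite sT ltW.
  move=> t /andP[st tT]; have := Jmono s t bs st tT.
  have := J_le1 t (inI t _); rewrite tT (le_trans (ltW bs) st) => /(_ isT) Jt.
  have := J_gt0 s (inI s _); rewrite sT (ltW bs) => /(_ isT) Js.
  have : C * (t - s) <= C * (T - b) by rewrite ler_wpM2l//; lra.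
  by move: J1s; rewrite mulrBr; lra.
exists b, (1 + C * (T - b) + D); split=> // t ht.
have ht' : b <= t < T by case/andP: ht => /ltW -> ->.
have D0 : 0 <= D by rewrite /D; do !rewrite addr_ge0.
have := HJ1 t ht'; have := J1_le t ht; have := normr_ge0 (H t).
by move=> *; split; lra.
Qed.

Lemma H_cvg : exists h : R, H t @[t --> T^'-] --> h.
Proof.
have [b [B [ab bT HB]]] := J1_H_bounded.
have inI t : b < t < T -> a < t < T.
  by move=> /andP[bt ->]; rewrite (lt_trans ab bt).
pose C := 2 * `|c| + B.
(* The sign [s] treats [H] and [- H] at once: the [K] in the derivative of [J1 / 2] absorbs that of
   [|H1|], and [C] the bounded terms. *)
have half (s : R) : `|s| = 1 ->
    exists l : R, s * H t + J1 t / 2 + C * t @[t --> T^'-] --> l.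
  move=> s1; have sX x : - `|x| <= s * x <= `|x|.
    by rewrite -ler_norml normrM s1 mul1r.
  apply: (nondecreasing_left_cvg (fun t => s * H t + J1 t / 2 + C * t) b T (2 * B + `|C| * (`|b| + `|T|))) => //.
    apply: (der_ge0_le (fun t => s * H t + J1 t / 2 + C * t)
      (fun t => s * H1 t + (2 * K t + 2 * H t + E t) / 2 + C)).
      move=> t /inI ht.
      apply: der_eq (derD _ _ _ _ _ (derD _ _ _ _ _ (derM _ _ _ _ _ (derC s t) (dH t ht))
        (derM _ _ _ _ _ (dJ1 t ht) (derC (2^-1) t)))
        (derM _ _ _ _ _ (derC C t) (der_id t))) _ _ => //=.
      by ring.
    move=> t hb; have ht := inI t hb.
    have [_] := HB t hb; have := E_le t ht; have := H1_le t ht.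
    have /andP[] := sX (H1 t); have := K_ge0 t ht.
    rewrite !ler_norml => ? ? ? /andP[? ?] /andP[? ?] /andP[? ?].
    have := ler_norm c; rewrite /C.
    by have := ler_norm (H1 t); have := H1_le t ht; lra.
  move=> t hb; have [j1 h1] := HB t hb; have /andP[_ s2] := sX (H t).
  have : C * t <= `|C| * (`|b| + `|T|).
    rewrite (le_trans (ler_norm _))// normrM ler_wpM2l//.
    case/andP: hb => ? ?; have [|] := ger0P t => t0.
      by have := ler_norm T; have := normr_ge0 b; lra.
    by have := ler_norm (- b); have := normr_ge0 T; rewrite normrN; lra.
  by have := normr_ge0 (H t); lra.
have [l1 hl1] := half 1 (normr1 _).
have [l2 hl2] := half (-1) (normrN1 _).
exists ((l1 - l2) / 2).
rewrite (_ : H = fun t => ((1 * H t + J1 t / 2 + C * t)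
    - (-1 * H t + J1 t / 2 + C * t)) / 2); last by apply/funext => t; field.
by apply: cvgM; [exact: cvgB|exact: cvg_cst].
Qed.

(** * Eventual convexity of [J] and Sundman's monotone function *)

Let w t := Num.sqrt (J t).

Let w_gt0 t : a < t < T -> 0 < w t.
Proof. by move=> /J_gt0; rewrite sqrtr_gt0. Qed.

Let sqr_w t : a < t < T -> w t ^+ 2 = J t.
Proof. by move=> /J_gt0/ltW; exact: sqr_sqrtr. Qed.

Let dw t : a < t < T -> der w t (J1 t / (2 * w t)).
Proof. by move=> ht; apply: der_sqrt; [exact: J_gt0|exact: dJ]. Qed.

Let w_lim : w t @[t --> T^'-] --> 0.
Proof.
rewrite -[X in _ --> X]sqrtr0; apply: continuous_cvg => //.
exact: sqrt_continuous.
Qed.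

Lemma J_convex_decreasing : exists b C, [/\ a < b, b < T &
  forall t, b < t < T -> [/\ J1 t < 0, kappa / w t <= 2 * K t + 2 * H t + E t,
    `|2 * H t + E t| <= C & `|4 * H t + E t| <= C]].
Proof.
have [b [B [ab bT HB]]] := J1_H_bounded.
pose C := 4 * `|B| + `|c|.
have C_ge0 : 0 <= C by rewrite addr_ge0// mulr_ge0.
have inI t : b < t < T -> a < t < T.
  by move=> /andP[bt ->]; rewrite (lt_trans ab bt).
have EH t : b < t < T -> `|2 * H t + E t| <= C /\ `|4 * H t + E t| <= C.
  move=> hb; have [_] := HB t hb; have := E_le t (inI t hb).
  rewrite !ler_norml /C => /andP[? ?] /andP[? ?].
  have := ler_norm B; have := ler_norm c.
  by move=> ? ?; split; apply/andP; split; lra.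
(* Below this threshold [kappa / w] exceeds [C]. Then, in [2 * U + 4 * H + E], one of the two copies
   of [kappa / w] pays for [4 * H + E] and the other remains. *)
have [|b' b'T w_lt] := left_lt w T 0 (kappa / (C + 1)) w_lim.
  by rewrite divr_gt0// ltr_wpDl.
pose s := Num.max b b'.
have [bs b's] : b <= s /\ b' <= s by rewrite !le_max !lexx orbT.
have sT : s < T by rewrite gt_max bT b'T.
have J2_ge t : s < t < T -> kappa / w t <= 2 * K t + 2 * H t + E t.
  move=> /andP[st tT]; have hb : b < t < T by rewrite tT (le_lt_trans bs st).
  have [_ EH4] := EH t hb; have ht := inI t hb.
  have : C < kappa / w t.
    rewrite ltr_pdivlMr ?w_gt0//.
    have : w t < kappa / (C + 1) by apply: w_lt; rewrite tT (le_lt_trans b's st).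
    rewrite ltr_pdivlMr ?ltr_wpDl//; have := w_gt0 t ht; lra.
  move: EH4; rewrite ler_norml => /andP[? ?]; have := U_ge t ht; rewrite -/(w t).
  by have := HE t; lra.
exists s, C; split=> // [|t /andP[st tT]]; first exact: lt_le_trans ab bs.
have hb : b < t < T by rewrite tT (le_lt_trans bs st).
have [EH2 EH4] := EH t hb; split=> //; last by apply: J2_ge; rewrite st.
(* [J1] is nondecreasing from here on, so a nonnegative value would persist up to [T]. *)
rewrite ltNge; apply/negP => J1t; apply: (J1_not_ge0 t (inI t hb)) => x /andP[tx xT].
apply: (le_trans J1t).
apply: (der_ge0_le J1 (fun t => 2 * K t + 2 * H t + E t) s T) => // y /andP[sy yT].
  by apply: dJ1; rewrite yT (le_lt_trans _ sy)//; apply: ltW; exact: lt_le_trans bs.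
apply: le_trans (J2_ge y _); last by rewrite sy.
rewrite divr_ge0 ?ltW// w_gt0// yT (le_lt_trans _ sy)//.
by apply: ltW; exact: lt_le_trans bs.
Qed.

Lemma sundman_cvg : exists2 l : R, 0 < l & J1 t ^+ 2 / w t @[t --> T^'-] --> l.
Proof.
have [b [C [ab bT HC]]] := J_convex_decreasing.
have inI t : b < t < T -> a < t < T.
  by move=> /andP[bt ->]; rewrite (lt_trans ab bt).
(* The derivative of [4 * C * w] is [C] times the common factor [2 * J1 / w]. It compensates the
   lower bound [- C] of [2 * H + E], which is what remains once [J1^2 / (4 w^2)] is bounded by
   [2 * K]. *)
pose S t := J1 t ^+ 2 / w t + 4 * C * w t.
have S_noninc s t : b < s -> s <= t -> t < T -> S t <= S s.
  pose J2 t := 2 * K t + 2 * H t + E t.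
  apply: (der_le0_ge S (fun t => 2 * J1 t / w t * (J2 t - J1 t ^+ 2 / (4 * w t ^+ 2) + C))).
    move=> x /inI ht; have wx := w_gt0 x ht.
    apply: der_eq (derD _ _ _ _ _ (derM _ _ _ _ _
      (derM _ _ _ _ _ (dJ1 x ht) (dJ1 x ht)) (derV _ _ _ (lt0r_neq0 wx) (dw x ht)))
      (derM _ _ _ _ _ (derC (4 * C) x) (dw x ht))) _ _ => //=.
    by rewrite /J2; field; exact: lt0r_neq0.
  move=> x hb; have ht := inI x hb; have wx := w_gt0 x ht.
  have [J1x _ EH _] := HC x hb.
  apply: mulr_le0_ge0; first by rewrite pmulr_lle0 ?invr_gt0// pmulr_rle0 ?ltW.
  have : J1 x ^+ 2 / (4 * w x ^+ 2) <= 2 * K x.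
    rewrite ler_pdivrMr ?mulr_gt0 ?exprn_gt0// sqr_w//.
    by have := J1_sq x ht; lra.
  by move: EH; rewrite ler_norml /J2 => /andP[? ?]; lra.
have C_ge0 : 0 <= C.
  have [|_ _ EH _] := HC ((b + T) / 2); first by apply/andP; split; lra.
  by rewrite (le_trans _ EH).
pose s := (b + T) / 2.
have [bs sT] : b < s /\ s < T by rewrite /s; split; lra.
have Sbd t : s <= t < T -> J1 t ^+ 2 <= S s * w t.
  move=> /andP[st tT]; have ht : a < t < T.
    by apply: inI; rewrite tT (lt_le_trans bs st).
  have := S_noninc s t bs st tT; rewrite /S => Sst.
  have wt := w_gt0 t ht; rewrite -ler_pdivrMr//.
  have : 0 <= 4 * C * w t by rewrite !mulr_ge0// ltW.
  by rewrite /S in Sst *; lra.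
have J1_lim : J1 t ^+ 2 @[t --> T^'-] --> 0.
  apply: (squeeze_cvgr (f := fun=> 0) (h := fun t => S s * w t)).
  - by apply/near_leftP; exists s => // t /andP[st tT]; rewrite sqr_ge0 Sbd// tT ltW.
  - exact: cvg_cst.
  - by rewrite -[X in _ --> X](mulr0 (S s)); apply: cvgM => //; exact: cvg_cst.
(* Since [J1 < 0] and the derivative of [J1] is at least [kappa / w], [F] is nondecreasing. As it
   tends to 0 it is nonpositive, which yields the positive lower bound [4 * kappa] for
   [J1^2 / w]. *)
pose F t := 4 * kappa * w t - J1 t ^+ 2.
have F_lim : F t @[t --> T^'-] --> 0.
  rewrite -[X in _ --> X](subr0 0) -[X in X - _](mulr0 (4 * kappa)).
  by apply: cvgB => //; apply: cvgM => //; exact: cvg_cst.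
have F_le0 t : b < t < T -> F t <= 0.
  move=> btT; apply: (nondecreasing_left_le F b T 0 _ F_lim t btT).
  apply: (der_ge0_le F (fun t => 2 * J1 t * (kappa / w t - (2 * K t + 2 * H t + E t)))).
    move=> x /inI ht; have wx := w_gt0 x ht.
    apply: der_eq (derD _ _ _ _ _ (derM _ _ _ _ _ (derC (4 * kappa) x) (dw x ht))
      (derN _ _ _ (derM _ _ _ _ _ (dJ1 x ht) (dJ1 x ht)))) _ _ => //=.
    by field; exact: lt0r_neq0.
  move=> x hb; have [J1x J2x _ _] := HC x hb.
  by apply: mulr_le0; [rewrite pmulr_rle0 ?ltW|rewrite subr_le0].
have [l Sl] : exists l : R, S t @[t --> T^'-] --> l.
  apply: (nonincreasing_left_cvg S b T 0 bT S_noninc) => t hb; have wt := w_gt0 t (inI t hb).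
  by apply: addr_ge0; [rewrite divr_ge0 ?sqr_ge0// ltW|rewrite !mulr_ge0// ltW].
have Ql : J1 t ^+ 2 / w t @[t --> T^'-] --> l.
  rewrite (_ : (fun t => _) = fun t => S t - 4 * C * w t); last first.
    by apply/funext => t; rewrite /S addrK.
  rewrite -[X in _ --> X](subr0 l) -[X in l - X](mulr0 (4 * C)).
  by apply: cvgB => //; apply: cvgM => //; exact: cvg_cst.
exists l => //; apply: (@lt_le_trans _ _ (4 * kappa)); first by rewrite mulr_gt0.
apply: (left_lim_ge _ b T _ _ bT Ql) => t hb.
rewrite ler_pdivlMr ?w_gt0 ?inI//.
by have := F_le0 t hb; rewrite /F subr_le0.
Qed.

(** * Integration of Sundman's limit and the asymptotics of all quantities *)

Lemma J_asymptotics : exists A : R, [/\ 0 < A,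
  J t / (T - t) `^ (4 / 3) @[t --> T^'-] --> A &
  J1 t / (T - t) `^ (1 / 3) @[t --> T^'-] --> - (4 * A / 3)].
Proof.
have [b [C [ab bT HC]]] := J_convex_decreasing.
have inI t : b < t < T -> a < t < T.
  by move=> /andP[bt ->]; rewrite (lt_trans ab bt).
have [l l0 Ql] := sundman_cvg.
have sQl : Num.sqrt (J1 t ^+ 2 / w t) @[t --> T^'-] --> Num.sqrt l.
  by apply: continuous_cvg Ql; exact: sqrt_continuous.
pose v t := J t `^ (3 / 4).
have J14 t : a < t < T -> J t `^ (1 / 4) = Num.sqrt (w t).
  move=> ht; rewrite -powR12_sqrt ?sqrtr_ge0// /w -powR12_sqrt ?ltW ?J_gt0//.
  by rewrite -powRrM; congr (_ `^ _); lra.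
(* The negative root is the right one because [J1 < 0]. *)
have J1E t : b < t < T -> J1 t = - Num.sqrt (J1 t ^+ 2 / w t) * J t `^ (1 / 4).
  move=> hb; have ht := inI t hb; have [J1t _ _ _] := HC t hb.
  rewrite J14// mulNr -sqrtrM ?divr_ge0 ?sqr_ge0 ?sqrtr_ge0//.
  by rewrite divfK ?gt_eqF ?w_gt0// sqrtr_sqr ltr0_norm ?opprK.
pose beta := 3 / 4 * Num.sqrt l.
have beta0 : 0 < beta by rewrite mulr_gt0 ?sqrtr_gt0.
have v_lim : v t @[t --> T^'-] --> 0.
  (* [powR_continuous] covers only positive points, so [v] is compared with [w * sqrt w], using the
     continuity of the square root at 0. *)
  have : w t * Num.sqrt (w t) @[t --> T^'-] --> 0 * Num.sqrt (0 : R).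
    apply: cvgM => //; apply: continuous_cvg w_lim; exact: sqrt_continuous.
  rewrite mul0r => h; apply: cvg_trans h; apply: near_eq_cvg.
  apply/near_leftP; exists a => // t ht; rewrite -J14// /w /v.
  rewrite -powR12_sqrt ?ltW ?J_gt0// -powRD.
    by congr (_ `^ _); lra.
  by apply/implyP => _; rewrite gt_eqF// J_gt0.
have vtau : v t / (T - t) @[t --> T^'-] --> beta.
  (* L'Hopital's rule integrates the limit of the derivative of [v]: both [v] and [T - t] vanish at
     [T]. *)
  apply: (@lhopital_at_left R v (fun t => 3 / 4 * J t `^ (3 / 4 - 1) * J1 t)
    (fun t => T - t) (fun=> -1) b T beta bT).
  - move=> x; rewrite in_itv/= => hb; have ht := inI x hb.
    apply: (der_comp J (fun y => y `^ (3 / 4))); last exact: dJ.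
    by apply: is_derive1_powR; exact: J_gt0.
  - move=> x _; apply: der_eq (derD _ _ _ _ _ (derC T x) (derN _ _ _ (der_id x))) _ _ => //.
    by rewrite add0r.
  - exact: v_lim.
  - rewrite -[X in _ --> X](subrr T); apply: cvgB; first exact: cvg_cst.
    by apply: cvg_at_left_filter; exact: cvg_id.
  - by move=> x _; rewrite oppr_eq0 oner_eq0.
  have : 3 / 4 * Num.sqrt (J1 t ^+ 2 / w t) @[t --> T^'-] --> beta.
    by apply: cvgM => //; exact: cvg_cst.
  apply: cvg_trans; apply: near_eq_cvg; apply/near_leftP; exists b => // t hb.
  have ht := inI t hb; rewrite {2}(J1E t hb) invrN invr1 mulrN1.
  have JJ : J t `^ (3 / 4 - 1) * J t `^ (1 / 4) = 1.
    rewrite -powRD; first by rewrite (_ : 3 / 4 - 1 + 1 / 4 = 0) ?powRr0//; lra.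
    by apply/implyP => _; rewrite gt_eqF// J_gt0.
  transitivity (3 / 4 * Num.sqrt (J1 t ^+ 2 / w t) * (J t `^ (3 / 4 - 1) * J t `^ (1 / 4))).
    by rewrite JJ mulr1.
  by ring.
exists (beta `^ (4 / 3)); split; first exact: powR_gt0.
  apply: cvg_trans (cvg_powR _ _ _ _ _ (4 / 3) beta0 vtau).
  apply: near_eq_cvg; apply/near_leftP; exists a => // t ht.
  have J0 := J_gt0 t ht; case/andP: ht => at_ tT.
  rewrite powR_div ?powR_ge0 ?subr_gt0// /v -powRrM.
  by rewrite (_ : 3 / 4 * (4 / 3) = 1) ?powRr1 ?ltW//; lra.
(* With [A = beta^(4/3)], one factor [beta = (3/4) sqrt l] is split off; the other factor
   [beta^(1/3)] is the limit of [(v / (T - t))^(1/3)], where [v^(1/3) = J^(1/4)]. *)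
have -> : - (4 * beta `^ (4 / 3) / 3) = - Num.sqrt l * beta `^ (1 / 3).
  rewrite (_ : 4 / 3 = 1 + 1 / 3) ?powRD ?powRr1 ?ltW//; last lra.
    by rewrite {1}/beta; field.
  by apply/implyP => _; rewrite gt_eqF.
have : - Num.sqrt (J1 t ^+ 2 / w t) * (v t / (T - t)) `^ (1 / 3) @[t --> T^'-]
    --> - Num.sqrt l * beta `^ (1 / 3).
  by apply: cvgM; [exact: cvgN|exact: cvg_powR].
apply: cvg_trans; apply: near_eq_cvg; apply/near_leftP; exists b => // t hb.
rewrite {2}(J1E t hb); have J0 := J_gt0 t (inI t hb); case/andP: hb => bt tT.
rewrite powR_div ?powR_ge0 ?subr_gt0// /v -powRrM mulrA.
by rewrite (_ : 3 / 4 * (1 / 3) = 1 / 4)//; lra.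
Qed.

Theorem collapse_asymptotics : exists A : R, 0 < A /\
  (J t / (T - t) `^ (4 / 3) @[t --> T^'-] --> A) /\
  (J1 t / (T - t) `^ (1 / 3) @[t --> T^'-] --> - (4 * A / 3)) /\
  ((2 * K t + 2 * H t + E t) / (T - t) `^ (- (2 / 3)) @[t --> T^'-] --> 4 * A / 9) /\
  (U t / (T - t) `^ (- (2 / 3)) @[t --> T^'-] --> 2 * A / 9) /\
  (K t / (T - t) `^ (- (2 / 3)) @[t --> T^'-] --> 2 * A / 9) /\
  (exists h : R, H t @[t --> T^'-] --> h).
Proof.
have [A [A0 JA J1A]] := J_asymptotics.
have [b [B [ab bT HB]]] := J1_H_bounded.
have [b' [C [ab' b'T HC]]] := J_convex_decreasing.
pose s := Num.max b b'.
have [bs b's] : b <= s /\ b' <= s by rewrite !le_max !lexx orbT.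
have sT : s < T by rewrite gt_max bT b'T.
have inI t : s < t < T -> [/\ a < t < T, b < t < T & b' < t < T].
  move=> /andP[st tT]; split; rewrite tT andbT ?(le_lt_trans bs st)//.
    exact: lt_trans ab (le_lt_trans bs st).
  exact: le_lt_trans b's st.
have kappa_le_U t : a < t < T -> kappa <= U t.
  move=> ht; apply: le_trans (U_ge t ht); rewrite -/(w t) ler_pdivlMr ?w_gt0//.
  rewrite -[leRHS]mulr1 ler_wpM2l ?(ltW kappa_gt0)//.
  by rewrite /w -[leRHS]sqrtr1 ler_wsqrtr// J_le1.
have U0 t : a < t < T -> 0 < U t.
  by move=> /kappa_le_U; apply: lt_le_trans.
have c0 : 0 <= c.
  by have := E_le _ mid_in; apply: le_trans.
(* [K = U + H], and [kappa <= U] turns the bound on [H] into a multiple of [U]; hence [|U1|] is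
   bounded by a multiple of [U^(5/2)]. *)
pose M := 1 + `|B| / kappa.
have K_le t : s < t < T -> K t <= M * U t.
  move=> hs; have [ht hb _] := inI t hs; have [_] := HB t hb.
  have : `|B| <= `|B| / kappa * U t.
    by rewrite mulrAC ler_pdivlMr// ler_wpM2l// kappa_le_U.
  have := ler_norm B; have := ler_norm (H t); rewrite HE /M mulrDl mul1r; lra.
have UA : U t / (T - t) `^ (- (2 / 3)) @[t --> T^'-] --> 2 * A / 9.
  (* The derivative of [J1] is read as [2 * U] plus the bounded term [4 * H + E]. *)
  apply: (tauberian J1 U U1 (fun t => 4 * H t + E t) s T A C (c * Num.sqrt M) sT A0) => //.
  - move=> t /inI[ht _ _]; apply: der_eq (dJ1 t ht) _ _ => //.
    by rewrite HE; ring.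
  - by move=> t /inI[_ _ hb]; have [] := HC t hb.
  - by move=> t /inI[ht _ _]; exact: U0.
  - by move=> t /inI[ht _ _]; exact: dU.
  move=> t hs; have [ht _ _] := inI t hs; apply: le_trans (U1_le t ht) _.
  have Ut := U0 t ht.
  have -> : U t `^ (5 / 2) = Num.sqrt (U t) * U t ^+ 2.
    rewrite -powR12_sqrt ?ltW// -powR_mulrn ?ltW// -powRD.
      by congr (_ `^ _); lra.
    by apply/implyP => _; rewrite gt_eqF.
  have : Num.sqrt (K t) <= Num.sqrt M * Num.sqrt (U t).
    rewrite -sqrtrM; first by rewrite ler_wsqrtr// K_le.
    by rewrite addr_ge0// divr_ge0// ltW.
  move=> /(ler_wpM2l c0)/(ler_wpM2r (sqr_ge0 (U t))).
  by rewrite -!mulrA.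
have [h Hh] := H_cvg.
have small e : (forall t, s < t < T -> `|e t| <= B + C) ->
    e t / (T - t) `^ (- (2 / 3)) @[t --> T^'-] --> 0.
  by move=> eB; apply: (bounded_div_gap_cvg0 _ s T (B + C)).
have Hlim : H t / (T - t) `^ (- (2 / 3)) @[t --> T^'-] --> 0.
  apply: small => t /inI[_ hb hb']; have [_ HtB] := HB t hb.
  have [_ _ _ HtC] := HC t hb'.
  by have := normr_ge0 (4 * H t + E t); lra.
have Elim : (4 * H t + E t) / (T - t) `^ (- (2 / 3)) @[t --> T^'-] --> 0.
  apply: small => t /inI[_ hb hb']; have [_ HtB] := HB t hb.
  have [_ _ _ HtC] := HC t hb'.
  by have := normr_ge0 (H t); lra.
exists A; split=> //; split=> //; split=> //; split; last (split=> //; split; last by exists h).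
  rewrite (_ : (fun t => _) = fun t => 2 * (U t / (T - t) `^ (- (2 / 3))) +
    (4 * H t + E t) / (T - t) `^ (- (2 / 3))); last first.
    by apply/funext => t; rewrite HE; ring.
  rewrite (_ : 4 * A / 9 = 2 * (2 * A / 9) + 0); last by field.
  by apply: cvgD => //; apply: cvgM => //; exact: cvg_cst.
rewrite (_ : (fun t => _) = fun t => U t / (T - t) `^ (- (2 / 3)) +
    H t / (T - t) `^ (- (2 / 3))); last first.
  by apply/funext => t; rewrite HE; ring.
by rewrite -[X in _ --> X]addr0; apply: cvgD.
Qed.

End Collapse.

(** * The cluster identities *)

Lemma der_sum {R : realType} (I : finType) (P : pred I) (f : I -> R -> R) (df : I -> R)
    (x : R) : (forall i, P i -> der (f i) x (df i)) ->
  der (fun t => \sum_(i | P i) f i t) x (\sum_(i | P i) df i).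
Proof.
move=> hf; elim: (index_enum I) => [|i r IH].
  apply: der_eq (derC 0 x) _ _ => [t|]; by rewrite big_nil.
rewrite big_cons; case: ifPn => Pi; last first.
  by apply: der_eq IH _ _ => // t; rewrite big_cons (negbTE Pi).
by apply: der_eq (derD _ _ _ _ _ (hf i Pi) IH) _ _ => // t; rewrite big_cons Pi.
Qed.

Lemma cvg_sum_pred {R : realType} (I : finType) (P : pred I) (f : I -> R -> R) (l : I -> R)
    (F : set_system R) (FF : Filter F) : (forall i, P i -> f i t @[t --> F] --> l i) ->
  \sum_(i | P i) f i t @[t --> F] --> \sum_(i | P i) l i.
Proof.
move=> fl; elim: (index_enum I) => [|i r IH].
  rewrite big_nil (_ : (fun t => _) = fun=> 0); first exact: cvg_cst.
  by apply/funext => t; rewrite big_nil.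
rewrite big_cons; case: ifPn => Pi; last first.
  rewrite (_ : (fun t => _) = fun t => \sum_(i <- r | P i) f i t) //.
  by apply/funext => t; rewrite big_cons (negbTE Pi).
rewrite (_ : (fun t => _) = fun t => f i t + \sum_(i <- r | P i) f i t).
  by apply: cvgD => //; exact: fl.
by apply/funext => t; rewrite big_cons Pi.
Qed.

Lemma sum_ge_term {R : realType} (I : finType) (P : pred I) (F : I -> R) (i : I) :
  P i -> (forall j, P j -> 0 <= F j) -> F i <= \sum_(j | P j) F j.
Proof.
move=> Pi F0; rewrite (bigD1 i)//= lerDl sumr_ge0// => j /andP[Pj _]; exact: F0.
Qed.

(** The terms with [j < i] are relabelled by exchanging the two sums, which puts action and reaction
    side by side. *)
Lemma sum_offdiag {R : realType} (n : nat) (G : {set 'I_n}) (a : 'I_n -> 'I_n -> R) :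
  \sum_(i in G) \sum_(j in G | j != i) a i j =
  \sum_(i in G) \sum_(j in G | (i < j)%N) (a i j + a j i).
Proof.
transitivity (\sum_(i in G) (\sum_(j in G | (i < j)%N) a i j +
    \sum_(j in G | (j < i)%N) a i j)).
  apply: eq_bigr => i iG; rewrite (bigID (fun j : 'I_n => (i < j)%N))/=; congr (_ + _).
    apply: eq_bigl => j; rewrite -andbA; congr andb.
    by rewrite -val_eqE /=; case: ltngtP.
  apply: eq_bigl => j; rewrite -andbA; congr andb.
  by rewrite -val_eqE /=; case: ltngtP.
rewrite big_split /= [X in _ + X](exchange_big_dep (mem G))//=; last first.
  by move=> i j _ /andP[].
rewrite -big_split/=; apply: eq_bigr => i iG; rewrite big_split/=; congr (_ + _).
by apply: eq_bigl => j; rewrite iG.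
Qed.

(* The plain name denotes the extended distance of MathComp-Analysis. *)
Local Notation edist := Defs.edist.

(** * Elementary properties of the Euclidean distance *)

Section EuclideanDistance.
Context {R : realType} {d : nat}.
Implicit Types x y z : 'I_d -> R.

Lemma edist_sqr x y : edist x y ^+ 2 = \sum_(k < d) (x k - y k) ^+ 2.
Proof. by rewrite sqr_sqrtr// sumr_ge0// => k _; exact: sqr_ge0. Qed.

Lemma edist_gt0 x y : x <> y -> 0 < edist x y.
Proof.
move=> xy; rewrite sqrtr_gt0 lt0r sumr_ge0 ?andbT; last by move=> k _; exact: sqr_ge0.
apply/negP => /eqP s0; apply: xy; apply/funext => k.
move/eqP: s0; rewrite psumr_eq0; last by move=> j _; exact: sqr_ge0.
move=> /allP/(_ k); rewrite mem_index_enum => /(_ isT).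
by rewrite /= sqrf_eq0 subr_eq0 => /eqP.
Qed.

Lemma edistC x y : edist x y = edist y x.
Proof. by rewrite /edist /enorm; congr Num.sqrt; apply: eq_bigr => k _; rewrite -sqrrN opprB. Qed.

Lemma ler_coord_edist x y k : `|x k - y k| <= edist x y.
Proof.
rewrite -sqrtr_sqr ler_wsqrtr//.
by apply: (@sum_ge_term R _ _ (fun k => (x k - y k) ^+ 2)) => // j _; exact: sqr_ge0.
Qed.

End EuclideanDistance.

(** * The cluster of the n-body problem satisfies the abstract inequalities *)

Section Cluster.
Context {R : realType} {n d : nat} (m : 'I_n -> R) (q : R -> 'I_n -> 'I_d -> R)
  (t0 T : R) (L : 'I_n -> 'I_d -> R) (G : {set 'I_n}).
Hypothesis m_gt0 : forall i, 0 < m i.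
Hypothesis t0T : t0 < T.
Hypothesis newton : forall t i k, t0 < t < T ->
  derivable (qcoord q i k) t 1 /\ derivable (derive1 (qcoord q i k)) t 1 /\
  m i * derive1n 2 (qcoord q i k) t = newton_force m q t i k.
Hypothesis no_collision : forall t i j, t0 <= t < T -> i != j -> q t i <> q t j.
Hypothesis q_lim : forall i k, qcoord q i k t @[t --> T^'-] --> L i k.
Hypothesis card_G : (2 <= #|G|)%N.
Hypothesis L_const : forall i j, i \in G -> j \in G -> L i = L j.
Hypothesis L_cluster : forall i j, i \in G -> j \notin G -> L j <> L i.

Let v i k t := derive1 (qcoord q i k) t.
Let acc i k t := derive1 (v i k) t.

Let J := J_G m L G q.
Let K := K_G m G q.
Let U := U_G m G q.
Let H := H_G m G q.

(** Newton's force is split because the external part stays bounded near [T], while the internal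
    part is handled by its symmetry. *)
Let ext_force t i k :=
  \sum_(j < n | j \notin G) m i * m j * (q t j k - q t i k) / edist (q t i) (q t j) ^+ 3.
Let int_force t i k :=
  \sum_(j in G | j != i) m i * m j * (q t j k - q t i k) / edist (q t i) (q t j) ^+ 3.

Let J1 t := \sum_(i in G) m i * \sum_(k < d) 2 * (q t i k - L i k) * v i k t.
(** Twice the virial of the external forces about the limit point. *)
Let E t := \sum_(i in G) \sum_(k < d) 2 * (q t i k - L i k) * ext_force t i k.
(** The power of the external forces. *)
Let H1 t := \sum_(i in G) \sum_(k < d) v i k t * ext_force t i k.
(** Written in the shape produced by [virial] with the velocities, so that it is visibly also the
    power of the internal forces. *)
Let U1 t := \sum_(i in G) \sum_(j in G | (i < j)%N) m i * m j *
  - ((\sum_(k < d) (v i k t - v j k t) * (q t i k - q t j k)) / edist (q t i) (q t j) ^+ 3).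

Let dist_gt0 t i j : t0 < t < T -> i != j -> 0 < edist (q t i) (q t j).
Proof.
move=> /andP[t0t tT] ij; apply: edist_gt0; apply: no_collision => //.
by rewrite tT ltW.
Qed.

Let dq t i k : t0 < t < T -> der (fun t => q t i k) t (v i k t).
Proof. by move=> ht; have [? _] := newton t i k ht; rewrite /v derive1E; exact/derivableP. Qed.

Let dv t i k : t0 < t < T -> der (v i k) t (acc i k t).
Proof. by move=> ht; have [_ [? _]] := newton t i k ht; rewrite /acc derive1E; exact/derivableP. Qed.

Let accE t i k : t0 < t < T -> i \in G ->
  m i * acc i k t = int_force t i k + ext_force t i k.
Proof.
move=> ht iG; have [_ [_ Fik]] := newton t i k ht.
transitivity (newton_force m q t i k); first exact: Fik.
rewrite /newton_force (bigID (mem G))/=; congr (_ + _).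
  by apply: eq_bigl => j; rewrite andbC.
(* For [i] in [G], a body outside [G] is automatically different from [i]. *)
apply: eq_bigl => j; rewrite andbC; case: (boolP (j \in G)) => //= jG.
by apply: contraNneq jG => ->.
Qed.

(* Newton's third law: pairing the (i, j) and (j, i) terms. *)
Lemma virial (z : 'I_n -> 'I_d -> R) t :
  \sum_(i in G) \sum_(k < d) z i k * int_force t i k =
  \sum_(i in G) \sum_(j in G | (i < j)%N) m i * m j *
  - ((\sum_(k < d) (z i k - z j k) * (q t i k - q t j k)) / edist (q t i) (q t j) ^+ 3).
Proof.
pose f i j := m i * m j * (\sum_(k < d) z i k * (q t j k - q t i k)) / edist (q t i) (q t j) ^+ 3.
transitivity (\sum_(i in G) \sum_(j in G | j != i) f i j).
  apply: eq_bigr => i iG; under eq_bigr do rewrite /int_force big_distrr/=.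
  rewrite exchange_big/=; apply: eq_bigr => j _.
  rewrite /f mulr_sumr mulr_suml; apply: eq_bigr => k _; ring.
rewrite sum_offdiag; apply: eq_bigr => i iG; apply: eq_bigr => j jG.
rewrite /f (edistC (q t j)) [m j * m i]mulrC -mulrDl -mulrDr -mulrA; congr (_ * _).
rewrite -mulNr; congr (_ / _); rewrite -sumrN -big_split/=; apply: eq_bigr => k _; ring.
Qed.

(** Euler's identity for a potential of degree -1: the common limit cancels in each difference,
    leaving the squared distance over its cube. *)
Let virial_q t : t0 < t < T ->
  \sum_(i in G) \sum_(k < d) (q t i k - L i k) * int_force t i k = - U t.
Proof.
move=> ht; rewrite (virial (fun i k => q t i k - L i k))/= /U /U_G -sumrN.
apply: eq_bigr => i iG; rewrite -sumrN; apply: eq_bigr => j /andP[jG ij].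
rewrite mulrN; congr (- (_ * _)).
have D0 : 0 < edist (q t i) (q t j).
  by apply: dist_gt0 => //; rewrite -val_eqE /= neq_ltn ij.
have -> : \sum_(k < d) (q t i k - L i k - (q t j k - L j k)) * (q t i k - q t j k)
    = edist (q t i) (q t j) ^+ 2.
  rewrite edist_sqr; apply: eq_bigr => k _; rewrite (L_const i j)//; ring.
by field; exact: lt0r_neq0.
Qed.

Let dJ t : t0 < t < T -> der J t (J1 t).
Proof.
move=> ht; apply: der_sum => i iG.
apply: der_eq (derM _ _ _ _ _ (derC (m i) t) (der_sum _ _ _ _ _ (fun k _ =>
   derM _ _ _ _ _ (derD _ _ _ _ _ (dq t i k ht) (derC (- L i k) t))
   (derD _ _ _ _ _ (dq t i k ht) (derC (- L i k) t))))) _ _ => //.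
rewrite mul0r add0r; congr (_ * _); apply: eq_bigr => k _; ring.
Qed.

Let HE t : H t = K t - U t. Proof. by []. Qed.

Let KE t : \sum_(i in G) m i * \sum_(k < d) v i k t ^+ 2 = 2 * K t.
Proof. by rewrite /K /K_G mulrA divff ?mul1r. Qed.

(** The Lagrange-Jacobi identity [4 K - 2 U + E], rewritten by [H = K - U]. *)
Let dJ1 t : t0 < t < T -> der J1 t (2 * K t + 2 * H t + E t).
Proof.
move=> ht; apply: der_eq (der_sum _ _ _ _ _ (fun i _ =>
  derM _ _ _ _ _ (derC (m i) t) (der_sum _ _ _ _ _ (fun k _ =>
   derM _ _ _ _ _ (derM _ _ _ _ _ (derC 2 t)
     (derD _ _ _ _ _ (dq t i k ht) (derC (- L i k) t))) (dv t i k ht))))) _ _ => //.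
transitivity (2 * (2 * K t) +
  2 * \sum_(i in G) \sum_(k < d) (q t i k - L i k) * int_force t i k + E t); last first.
  by rewrite virial_q// HE; ring.
rewrite -KE /E !mulr_sumr -!big_split/=; apply: eq_bigr => i iG.
rewrite mul0r add0r !mulr_sumr -!big_split/=; apply: eq_bigr => k _.
have := accE t i k ht iG; rewrite -/(v i k) => mE.
transitivity (2 * (m i * v i k t ^+ 2) + 2 * (q t i k - L i k) * (m i * acc i k t)).
  by ring.
by rewrite mE; ring.
Qed.

Let dU t : t0 < t < T -> der U t (U1 t).
Proof.
move=> ht; apply: der_sum => i iG; apply: der_sum => j /andP[jG ij].
have D0 : 0 < edist (q t i) (q t j).
  by apply: dist_gt0 => //; rewrite -val_eqE /= neq_ltn ij.
have S0 : 0 < \sum_(k < d) (q t i k - q t j k) ^+ 2 by rewrite -edist_sqr exprn_gt0.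
have dS : der (fun t => \sum_(k < d) (q t i k - q t j k) ^+ 2) t
    (2 * \sum_(k < d) (v i k t - v j k t) * (q t i k - q t j k)).
  rewrite mulr_sumr; apply: der_sum => k _.
  pose dk := derD _ _ _ _ _ (dq t i k ht) (derN _ _ _ (dq t j k ht)).
  by apply: der_eq (derM _ _ _ _ _ dk dk) _ _ => //; ring.
apply: der_eq (derM _ _ _ _ _ (derC (m i * m j) t) (derV _ _ _ _ (der_sqrt _ _ _ S0 dS))) _ _ => //.
  by rewrite gt_eqF// sqrtr_gt0.
rewrite -/(edist (q t i) (q t j)) mul0r add0r; congr (_ * _).
rewrite -[Num.sqrt _]/(edist (q t i) (q t j)).
by field; exact: lt0r_neq0.
Qed.

(** Kinetic energy changes by the power of all forces; [virial] with the velocities identifies the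
    internal part with [U1], which then cancels in [dH]. *)
Let dK t : t0 < t < T -> der K t (U1 t + H1 t).
Proof.
move=> ht; rewrite /K /K_G.
apply: der_eq (derM _ _ _ _ _ (derC (2^-1) t) (der_sum _ _ _ _ _ (fun i _ =>
  derM _ _ _ _ _ (derC (m i) t) (der_sum _ _ _ _ _ (fun k _ =>
   derM _ _ _ _ _ (dv t i k ht) (dv t i k ht)))))) _ _ => //.
rewrite mul0r add0r /U1 -virial mulr_sumr /H1 -big_split/=; apply: eq_bigr => i iG.
rewrite mul0r add0r !mulr_sumr -big_split/=; apply: eq_bigr => k _.
have := accE t i k ht iG => mE.
transitivity (v i k t * (m i * acc i k t)); first by field.
by rewrite mE; ring.
Qed.

Let dH t : t0 < t < T -> der H t (H1 t).
Proof.
move=> ht; apply: der_eq (derD _ _ _ _ _ (dK t ht) (derN _ _ _ (dU t ht))) _ _ => //.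
by ring.
Qed.

Let J_ge_term t i : i \in G -> m i * \sum_(k < d) (q t i k - L i k) ^+ 2 <= J t.
Proof.
move=> iG; apply: (sum_ge_term _ (mem G) (fun i => m i * \sum_(k < d) (q t i k - L i k) ^+ 2)) => // j _.
by rewrite mulr_ge0 ?(ltW (m_gt0 j))// sumr_ge0// => k _; exact: sqr_ge0.
Qed.

(** Both bodies are compared with their common limit point, using [(x - y)^2 <= 2 x^2 + 2 y^2] in
    each coordinate. *)
Let dist_le_J t i j : i \in G -> j \in G ->
  edist (q t i) (q t j) ^+ 2 <= (2 / m i + 2 / m j) * J t.
Proof.
move=> iG jG; rewrite edist_sqr.
apply: (@le_trans _ _ (2 * \sum_(k < d) (q t i k - L i k) ^+ 2 +
    2 * \sum_(k < d) (q t j k - L j k) ^+ 2)).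
  rewrite !mulr_sumr -big_split/=; apply: ler_sum => k _.
  rewrite (L_const j i)// -subr_ge0.
  rewrite (_ : _ - _ = (q t i k - L i k + (q t j k - L i k)) ^+ 2) ?sqr_ge0//; ring.
rewrite [leRHS]mulrDl -!mulrA; apply: lerD; rewrite ler_wpM2l// ler_pdivlMl//;
  exact: J_ge_term.
Qed.

Let J_gt0 t : t0 < t < T -> 0 < J t.
Proof.
move=> ht; have /card_gt1P[i [j [iG jG ij]]] := card_G.
have := lt_le_trans (exprn_gt0 2 (dist_gt0 t i j ht ij)) (dist_le_J t i j iG jG).
by rewrite pmulr_rgt0// addr_gt0// divr_gt0.
Qed.

Let U_ge_term t i j : t0 < t < T -> i \in G -> j \in G -> (i < j)%N ->
  m i * m j / edist (q t i) (q t j) <= U t.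
Proof.
move=> ht iG jG ij.
have pos i' j' : 0 <= m i' * m j' / edist (q t i') (q t j').
  by rewrite divr_ge0 ?sqrtr_ge0// mulr_ge0 ?(ltW (m_gt0 _)).
apply: (@le_trans _ _ (\sum_(j in G | (i < j)%N) m i * m j / edist (q t i) (q t j))).
  apply: (sum_ge_term _ (fun j : 'I_n => (j \in G) && (i < j)%N)
    (fun j => m i * m j / edist (q t i) (q t j))) => //.
  by rewrite jG.
apply: (sum_ge_term _ (mem G) (fun i : 'I_n => \sum_(j in G | (i < j)%N)
  m i * m j / edist (q t i) (q t j))) => // i' _.
exact: sumr_ge0.
Qed.

(** A single pair suffices: [U] dominates its term, and its distance is at most a multiple of
    [sqrt J]. *)
Lemma U_ge_J : exists2 kappa : R, 0 < kappa &
  forall t, t0 < t < T -> kappa / Num.sqrt (J t) <= U t.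
Proof.
have [i [j [iG jG ij]]] : exists i j, [/\ i \in G, j \in G & (i < j)%N].
  have /card_gt1P[i [j [iG jG]]] := card_G.
  by rewrite -val_eqE /= neq_ltn => /orP[ij|ij]; [exists i, j|exists j, i].
have Mij : 0 < 2 / m i + 2 / m j by rewrite addr_gt0// divr_gt0.
exists (m i * m j / Num.sqrt (2 / m i + 2 / m j)).
  by rewrite divr_gt0 ?mulr_gt0 ?sqrtr_gt0.
move=> t ht; apply: le_trans (U_ge_term t i j ht iG jG ij).
rewrite -mulrA -invfM ler_wpM2l ?mulr_ge0 ?(ltW (m_gt0 _))//.
have D0 : 0 < edist (q t i) (q t j).
  by apply: dist_gt0 => //; rewrite -val_eqE /= neq_ltn ij.
rewrite lef_pV2 ?posrE// ?mulr_gt0 ?sqrtr_gt0 ?J_gt0//.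
rewrite -sqrtrM ?(ltW Mij)// -(ger0_norm (ltW D0)) -sqrtr_sqr ler_wsqrtr//.
exact: dist_le_J.
Qed.

(* The weighted Cauchy-Schwarz inequality, as nonnegativity of the weighted sum
   of the squares (v - mu (q - L))^2 for mu := J1 / (2 J). *)
Let J1_sq t : t0 < t < T -> J1 t ^+ 2 <= 8 * J t * K t.
Proof.
move=> ht; have J0 := J_gt0 t ht; set mu := J1 t / (2 * J t).
have : 0 <= 2 * K t - mu * J1 t + mu ^+ 2 * J t.
  suff -> : 2 * K t - mu * J1 t + mu ^+ 2 * J t = \sum_(i in G) m i *
      \sum_(k < d) (v i k t - mu * (q t i k - L i k)) ^+ 2.
    apply: sumr_ge0 => i _; rewrite mulr_ge0 ?(ltW (m_gt0 i))// sumr_ge0// => k _.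
    exact: sqr_ge0.
  rewrite -KE /J1 /J /J_G !mulr_sumr -sumrN -!big_split/=; apply: eq_bigr => i iG.
  rewrite !mulr_sumr -sumrN -!big_split/=; apply: eq_bigr => k _; ring.
have -> : 2 * K t - mu * J1 t + mu ^+ 2 * J t = (8 * J t * K t - J1 t ^+ 2) / (4 * J t).
  by rewrite /mu; field; exact: lt0r_neq0.
by rewrite pmulr_lge0 ?invr_gt0 ?mulr_gt0// subr_ge0.
Qed.

Let J_lim : J t @[t --> T^'-] --> 0.
Proof.
have -> : (0 : R) = \sum_(i in G) m i * \sum_(k < d) (L i k - L i k) ^+ 2.
  rewrite big1// => i _; rewrite big1 ?mulr0// => k _; by rewrite subrr expr0n.
apply: cvg_sum_pred => i _; apply: cvgM; first exact: cvg_cst.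
apply: cvg_sum_pred => k _; under eq_fun do rewrite expr2; rewrite expr2.
by apply: cvgM; (apply: cvgB; [exact: q_lim|exact: cvg_cst]).
Qed.

(** Bodies outside the cluster have limits different from that of the cluster, so no denominator
    tends to 0. *)
Let ext_force_cvg i k : i \in G -> exists l : R, ext_force t i k @[t --> T^'-] --> l.
Proof.
move=> iG; exists (\sum_(j < n | j \notin G) m i * m j * (L j k - L i k) /
  edist (L i) (L j) ^+ 3).
apply: cvg_sum_pred => j jG; apply: cvgM.
  apply: cvgM; first exact: cvg_cst.
  by apply: cvgB; exact: q_lim.
have D0 : 0 < edist (L i) (L j).
  by apply: edist_gt0 => /esym; exact: L_cluster.
apply: cvgV; first by rewrite gt_eqF// exprn_gt0.
have Dlim : edist (q t i) (q t j) @[t --> T^'-] --> edist (L i) (L j).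
  apply: continuous_cvg; first exact: sqrt_continuous.
  apply: cvg_sum_pred => k' _; under eq_fun do rewrite expr2; rewrite expr2.
  by apply: cvgM; apply: cvgB; exact: q_lim.
rewrite (_ : (fun t => _) = fun t => edist (q t i) (q t j) *
  (edist (q t i) (q t j) * edist (q t i) (q t j))).
  by rewrite exprS expr2; apply: cvgM => //; exact: cvgM.
by apply/funext => t; rewrite exprS expr2.
Qed.

Let E_cvg : exists l : R, E t @[t --> T^'-] --> l.
Proof.
(* Limits are chosen for all index pairs at once, with the dummy value 0 for bodies outside [G]. *)
have /choice[l lE] : forall ik : 'I_n * 'I_d, exists l : R, ik.1 \in G ->
    ext_force t ik.1 ik.2 @[t --> T^'-] --> l.
  move=> [i k]; have [iG|] := boolP (i \in G); last by exists 0.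
  by have [l hl] := ext_force_cvg i k iG; exists l.
exists (\sum_(i in G) \sum_(k < d) 2 * (L i k - L i k) * l (i, k)).
apply: cvg_sum_pred => i iG; apply: cvg_sum_pred => k _; apply: cvgM.
  apply: cvgM; first exact: cvg_cst.
  by apply: cvgB; [exact: q_lim|exact: cvg_cst].
exact: (lE (i, k)).
Qed.

(** The remainder of Young's inequality [|v f| <= m v^2 / 2 + f^2 / (2 m)], whose first term sums to
    [K]. *)
Let X t := \sum_(i in G) \sum_(k < d) ext_force t i k ^+ 2 / (2 * m i).

Let X_cvg : exists l : R, X t @[t --> T^'-] --> l.
Proof.
have /choice[l lE] : forall ik : 'I_n * 'I_d, exists l : R, ik.1 \in G ->
    ext_force t ik.1 ik.2 @[t --> T^'-] --> l.
  move=> [i k]; have [iG|] := boolP (i \in G); last by exists 0.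
  by have [l hl] := ext_force_cvg i k iG; exists l.
exists (\sum_(i in G) \sum_(k < d) l (i, k) ^+ 2 / (2 * m i)).
apply: cvg_sum_pred => i iG; apply: cvg_sum_pred => k _; apply: cvgM; last exact: cvg_cst.
under eq_fun do rewrite expr2; rewrite expr2.
by apply: cvgM; exact: (lE (i, k)).
Qed.

Let H1_le t : `|H1 t| <= K t + X t.
Proof.
have -> : K t = \sum_(i in G) \sum_(k < d) m i * v i k t ^+ 2 / 2.
  rewrite /K /K_G mulr_sumr; apply: eq_bigr => i _; rewrite !mulr_sumr.
  by apply: eq_bigr => k _; rewrite mulrC.
rewrite /X -big_split/=; apply: le_trans (ler_norm_sum _ _ _) _.
apply: ler_sum => i iG; rewrite -big_split/=; apply: le_trans (ler_norm_sum _ _ _) _.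
apply: ler_sum => k _; have mi := m_gt0 i; set x := v i k t; set f := ext_force t i k.
(* The two squares give Young's inequality for both signs of [x * f]. *)
have pm : 0 <= (m i * x + f) ^+ 2 / (2 * m i) by rewrite divr_ge0 ?sqr_ge0// mulr_ge0 ?ltW.
have mm : 0 <= (m i * x - f) ^+ 2 / (2 * m i) by rewrite divr_ge0 ?sqr_ge0// mulr_ge0 ?ltW.
have pE : (m i * x + f) ^+ 2 / (2 * m i) = m i * x ^+ 2 / 2 + f ^+ 2 / (2 * m i) + x * f.
  by field; exact: lt0r_neq0.
have mE : (m i * x - f) ^+ 2 / (2 * m i) = m i * x ^+ 2 / 2 + f ^+ 2 / (2 * m i) - x * f.
  by field; exact: lt0r_neq0.
by rewrite ler_norml; apply/andP; split; lra.
Qed.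

Let v_le t i k : i \in G -> `|v i k t| <= Num.sqrt (2 / m i) * Num.sqrt (K t).
Proof.
move=> iG; rewrite -sqrtrM ?divr_ge0 ?(ltW (m_gt0 i))// -sqrtr_sqr ler_wsqrtr//.
rewrite mulrAC ler_pdivlMr// -KE mulrC.
apply: (@le_trans _ _ (m i * \sum_(k < d) v i k t ^+ 2)).
  rewrite ler_wpM2l ?(ltW (m_gt0 i))//.
  by apply: (sum_ge_term _ xpredT (fun k => v i k t ^+ 2)) => // j _; exact: sqr_ge0.
apply: (sum_ge_term _ (mem G) (fun i => m i * \sum_(k < d) v i k t ^+ 2)) => // j _.
by rewrite mulr_ge0 ?(ltW (m_gt0 j))// sumr_ge0// => l _; exact: sqr_ge0.
Qed.

Let U1_le : exists2 c : R, 0 <= c & forall t, t0 < t < T ->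
  `|U1 t| <= c * Num.sqrt (K t) * U t ^+ 2.
Proof.
pose s i := Num.sqrt (2 / m i).
(* Velocities cost [s i + s j] times [sqrt K] in each of the [d] coordinates; the inverse masses
   come from rewriting [m_i m_j / D^2] through the square of [m_i m_j / D], a term of [U]. *)
pose w i j := (m i * m j)^-1 * (d%:R * (s i + s j)).
have w_ge0 i j : 0 <= w i j.
  by rewrite mulr_ge0 ?invr_ge0 ?mulr_ge0 ?(ltW (m_gt0 _))// addr_ge0 ?sqrtr_ge0.
exists (\sum_(i in G) \sum_(j in G | (i < j)%N) w i j).
  by apply: sumr_ge0 => i _; exact: sumr_ge0.
move=> t ht; rewrite !mulr_suml; apply: le_trans (ler_norm_sum _ _ _) _.
apply: ler_sum => i iG; rewrite !mulr_suml; apply: le_trans (ler_norm_sum _ _ _) _.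
apply: ler_sum => j /andP[jG ij].
have D0 : 0 < edist (q t i) (q t j).
  by apply: dist_gt0 => //; rewrite -val_eqE /= neq_ltn ij.
have UD := U_ge_term t i j ht iG jG ij; set D := edist (q t i) (q t j) in D0 UD *.
have mij : 0 < m i * m j by rewrite mulr_gt0.
have sum_le : `|\sum_(k < d) (v i k t - v j k t) * (q t i k - q t j k)| <=
    d%:R * (s i + s j) * Num.sqrt (K t) * D.
  apply: le_trans (ler_norm_sum _ _ _) _.
  rewrite -!mulrA mulr_natl -[X in _ *+ X](card_ord d) -sumr_const.
  apply: ler_sum => k _; rewrite normrM mulrA ler_pM ?normr_ge0//.
    rewrite mulrDl (le_trans (ler_normB _ _))// lerD// v_le//.
  exact: ler_coord_edist.
rewrite normrM normrN (gtr0_norm mij) normrM normfV (gtr0_norm (exprn_gt0 3 D0)).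
apply: (@le_trans _ _ (w i j * Num.sqrt (K t) * (m i * m j / D) ^+ 2)); last first.
  apply: ler_wpM2l; first exact: mulr_ge0 (w_ge0 i j) (sqrtr_ge0 _).
  rewrite ler_pXn2r// ?nnegrE ?divr_ge0 ?(ltW mij) ?(ltW D0)//.
  by rewrite (le_trans _ UD)// divr_ge0 ?(ltW mij) ?(ltW D0).
have -> : w i j * Num.sqrt (K t) * (m i * m j / D) ^+ 2 =
    m i * m j * (d%:R * (s i + s j) * Num.sqrt (K t) * D / D ^+ 3).
  by rewrite /w; field; rewrite !gt_eqF.
by rewrite ler_wpM2l ?(ltW mij)// ler_wpM2r// invr_ge0 exprn_ge0 ?(ltW D0).
Qed.

Theorem cluster_asymptotics : exists A : R, 0 < A /\
  (J t / (T - t) `^ (4 / 3) @[t --> T^'-] --> A) /\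
  (derive1 J t / (T - t) `^ (1 / 3) @[t --> T^'-] --> - (4 * A / 3)) /\
  (derive1n 2 J t / (T - t) `^ (- (2 / 3)) @[t --> T^'-] --> 4 * A / 9) /\
  (U t / (T - t) `^ (- (2 / 3)) @[t --> T^'-] --> 2 * A / 9) /\
  (K t / (T - t) `^ (- (2 / 3)) @[t --> T^'-] --> 2 * A / 9) /\
  (exists h : R, H t @[t --> T^'-] --> h).
Proof.
have J1E t : t0 < t < T -> derive1 J t = J1 t.
  by move=> /dJ[_ <-]; rewrite derive1E.
have J2E t : t0 < t < T -> derive1n 2 J t = 2 * K t + 2 * H t + E t.
  move=> ht; rewrite /derive1n/= derive1E; case: (dJ1 t ht) => _ <-.
  (* [J1] is known to be the derivative only on [(t0, T)]; openness gives equality near [t], enough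
     to differentiate again. *)
  apply: near_eq_derive; near=> s; apply: J1E; apply/andP; split; near: s.
    by apply: lt_nbhsr; case/andP: ht.
  by apply: lt_nbhsl; case/andP: ht.
have [kappa kappa0 U_ge] := U_ge_J.
have [c c0 U1c] := U1_le.
have [e /left_bounded[b1 b1T Eb]] := E_cvg.
have [x /left_bounded[b2 b2T Xb]] := X_cvg.
have [|b3 b3T J_lt1] := left_lt J T 0 1 J_lim; first exact: ltr01.
pose a := Num.max (Num.max t0 b1) (Num.max b2 b3).
have aT : a < T by rewrite !gt_max t0T b1T b2T b3T.
have inI t : a < t < T -> [/\ t0 < t < T, b1 < t < T, b2 < t < T & b3 < t < T].
  by move=> /andP[]; rewrite !gt_max => /andP[/andP[-> ->] /andP[-> ->]] ->.
(* One constant serves as the bound on [E], on [X] and in the estimate of [U1]. *)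
pose C := c + (`|e| + 1) + (`|x| + 1).
have [|||||||||||A [A0 [h1 [h2 [h3 h4]]]]] := @collapse_asymptotics R a T J J1 U K H E H1 U1
    C kappa aT HE _ _ J_lim _ _ _ _ _ _ kappa0.
- by move=> t /inI[ht _ _ _]; exact: J_gt0.
- by move=> t /inI[_ _ _ hb]; apply: ltW; exact: J_lt1.
- by move=> t /inI[ht _ _ _]; exact: dJ.
- by move=> t /inI[ht _ _ _]; exact: dJ1.
- move=> t /inI[_ hb _ _]; apply: le_trans (Eb t hb) _.
  by rewrite /C -addrA addrCA lerDl addr_ge0// addr_ge0.
- by move=> t /inI[ht _ _ _]; exact: dH.
- move=> t /inI[_ _ hb _]; apply: le_trans (H1_le t) _; rewrite lerD2l.
  apply: le_trans (ler_norm _) _; apply: le_trans (Xb t hb) _.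
  by rewrite /C lerDr addr_ge0// addr_ge0.
- by move=> t /inI[ht _ _ _]; exact: J1_sq.
- by move=> t /inI[ht _ _ _]; exact: U_ge.
- by move=> t /inI[ht _ _ _]; exact: dU.
- move=> t /inI[ht _ _ _]; apply: le_trans (U1c t ht) _.
  rewrite ler_wpM2r ?sqr_ge0// ler_wpM2r ?sqrtr_ge0//.
  by rewrite /C -addrA lerDl !addr_ge0.
exists A; split=> //; split=> //; split; last split=> //.
  apply: cvg_trans h2; apply: near_eq_cvg; apply/near_leftP; exists t0 => // t ht.
  by rewrite J1E.
apply: cvg_trans h3; apply: near_eq_cvg; apply/near_leftP; exists t0 => // t ht.
by rewrite J2E.
Unshelve. all: by end_near. Qed.

End Cluster.

Theorem theoremB1 (R : realType) (d n : nat) (m : 'I_n -> R)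
    (q : R -> 'I_n -> 'I_d -> R) (t0 T : R) (L : 'I_n -> 'I_d -> R)
    (G : {set 'I_n}) :
  (d = 2%N \/ d = 3%N) ->
  (2 <= n)%N ->
  (forall i, 0 < m i) ->
  t0 < T ->
  (* q is a solution of Newton's equations on (t0, T) *)
  (forall t i k, t0 < t < T ->
     derivable (qcoord q i k) t 1 /\ derivable (derive1 (qcoord q i k)) t 1 /\
     m i * derive1n 2 (qcoord q i k) t = newton_force m q t i k) ->
  (* no collisions before T *)
  (forall t i j, t0 <= t < T -> i != j -> q t i <> q t j) ->
  (* all limits L_i exist *)
  (forall i k, qcoord q i k t @[t --> T^'-] --> L i k) ->
  (* G is a cluster with at least two elements *)
  (2 <= #|G|)%N ->
  (forall i j, i \in G -> j \in G -> L i = L j) ->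
  (forall i j, i \in G -> j \notin G -> L j <> L i) ->
  exists A : R, 0 < A /\
    (J_G m L G q t / (T - t) `^ (4 / 3) @[t --> T^'-] --> A) /\
    (derive1 (J_G m L G q) t / (T - t) `^ (1 / 3) @[t --> T^'-] --> - (4 * A / 3)) /\
    (derive1n 2 (J_G m L G q) t / (T - t) `^ (- (2 / 3)) @[t --> T^'-] --> 4 * A / 9) /\
    (U_G m G q t / (T - t) `^ (- (2 / 3)) @[t --> T^'-] --> 2 * A / 9) /\
    (K_G m G q t / (T - t) `^ (- (2 / 3)) @[t --> T^'-] --> 2 * A / 9) /\
    (exists h : R, H_G m G q t @[t --> T^'-] --> h).
Proof. by move=> _ _; exact: cluster_asymptotics. Qed.
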